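(* Let $n$ be a positive integer, let $0<\alpha\leq 1$, and let $C\geq 0$ be a real constant. Suppose that the functions $D,E:\mathbb{D}\to\mathbb{C}$ satisfy $$|\operatorname{Im} E(z)|< n\alpha\,(\operatorname{Re} D(z)-C)\qquad (z\in\mathbb{D}).$$ If $p\in\mathcal{H}[1,n]$ satisfies $$C z^{2}p''(z)+D(z)\,zp'(z)+E(z)\,p(z)=0\qquad (z\in\mathbb{D})$$ and $p(z)\neq 0$ for $z\in\mathbb{D}$, then $p(z)\prec \left(\frac{1+z}{1-z}\right)^{\alpha}$.
   Context: $\mathbb{D}$ is the open unit disc in $\mathbb{C}$. For a natural number $n$, $\mathcal{H}[a,n]$ is the class of all analytic functions $p$ on $\mathbb{D}$ of the form $p(z)=a+p_nz^n+p_{n+1}z^{n+1}+\cdots$. For analytic functions $f,g$ on $\mathbb{D}$, $f\prec g$ ($f$ is subordinate to $g$) means there is an analytic $w:\mathbb{D}\to\mathbb{D}$ with $w(0)=0$ and $f(z)=g(w(z))$ for all $z\in\mathbb{D}$. The power $\left(\frac{1+z}{1-z}\right)^{\alpha}$ is the principal branch (value $1$ at $z=0$). *)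

(* Defs.v *)
From Stdlib Require Import Reals.
From Coquelicot Require Import Coquelicot.

Open Scope R_scope.

Definition in_disc (z : C) : Prop := Cmod z < 1.

(* Functions on the disc are total functions C -> C whose values outside the
   disc are irrelevant. The derivative is the complex one. *)
Definition analytic_on_disc (f : C -> C) : Prop :=
  forall z : C, in_disc z ->
    ex_derive (K := C_AbsRing) (V := C_NormedModule) f z.

(* H[a, n]: the middle condition kills the terms of degree 1, ..., n - 1. *)
Definition H_class (a : C) (n : nat) (p : C -> C) : Prop :=
  analytic_on_disc p /\
  exists c : nat -> C,
    c 0%nat = a /\
    (forall k : nat, (0 < k < n)%nat -> c k = RtoC 0) /\
    (forall z : C, in_disc z ->
       is_pseries (K := C_AbsRing) (V := C_NormedModule) c z (p z)).

Definition subordinate (f g : C -> C) : Prop :=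
  exists w : C -> C,
    analytic_on_disc w /\
    (forall z : C, in_disc z -> in_disc (w z)) /\
    w (RtoC 0) = RtoC 0 /\
    (forall z : C, in_disc z -> f z = g (w z)).

Definition Cexp (z : C) : C :=
  (exp (Re z) * cos (Im z), exp (Re z) * sin (Im z)).

(* Principal argument, in (-PI, PI]; the value at 0 is irrelevant. *)
Definition Carg (z : C) : R :=
  if Rlt_dec (Im z) 0 then - acos (Re z / Cmod z) else acos (Re z / Cmod z).

Definition Clog (z : C) : C := (ln (Cmod z), Carg z).

(* Principal branch, for z <> 0. *)
Definition Cpow_real (z : C) (a : R) : C := Cexp (RtoC a * Clog z)%C.

(* Main.v *)
(** If [p] leaves the sector [|arg p| < alpha * PI / 2], let [z0] be a point of smallest
    modulus where it does, and put [P = z p'/p] and [arg p (z0) = s * alpha * PI / 2] with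
    [s = 1] or [s = -1]. On [|z| <= |z0|] the principal logarithm of [p] is defined, and
    [w = (p^(1/alpha) - 1) / (p^(1/alpha) + 1)] maps into the closed unit disc and vanishes to
    order [n] at [0], so [|w (z)| <= |z/z0|^n] by the Schwarz lemma. Comparing the radial
    derivatives at [z0], where equality holds, gives [s * Im P >= n * alpha] (Jack, Nunokawa).
    On the circle [|z| = |z0|] the function [s * arg p] is maximal at [z0], so that [Re P = 0]
    and [s * Im (z P') >= 0] there. The differential equation divided by [p] reads
    [c (z P' - P + P^2) + D P + E = 0]; the imaginary part of it contradicts the
    hypothesis on [Im E]. *)

Require Import Defs.
From Stdlib Require Import Reals Lra Lia ClassicalEpsilon.
From Coquelicot Require Import Coquelicot.

(** * Complex derivatives *)

Notation Cder := (is_derive (K := C_AbsRing) (V := C_NormedModule)).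

(** The analytic tools are elementary: no contour integral occurs. The maximum principle comes from
    the second-derivative test along lines, once a small quadratic term makes the Laplacian of |f|^2
    strictly positive. The test needs two complex derivatives, which for [p] come from termwise
    differentiation of its power series.

    The chart z = z0 exp(x) serves three times. It turns the Schwarz lemma into a statement about a
    half-plane; real x gives the radial derivative at z0, imaginary x the derivative along the
    circle; and d/dx is always the operator z d/dz that produces P.

    The derivative of |w| itself is never taken. For u = p^(1/alpha), the bound |w| <= r forces
    cos(arg u) >= (1 - r^2) / (1 + r^2), whatever |u| is. With r = exp(n t) both sides vanish at t =
    0, so the inequality can be differentiated there from the left.

    The conditions alpha <= 1 and p <> 0 guard the logarithm: they keep the closed sector in the
    right half-plane and away from 0, hence off the slit, so that log p is differentiable at z0
    itself. *)

Lemma is_C_derive_eps (f : C -> C) (z l : C) :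
  Cder f z l <->
  forall eps, 0 < eps -> exists delta, 0 < delta /\
    forall h : C, Cmod h < delta -> Cmod (f (z + h) - f z - l * h)%C <= eps * Cmod h.
Proof.
  split.
  - intros [_ H] eps Heps.
    destruct (H z (fun P HP => HP) (mkposreal eps Heps)) as [d Hd].
    exists d; split; [apply cond_pos|].
    intros h Hh.
    specialize (Hd (z + h)%C).
    assert (E : minus (z + h)%C z = h) by (unfold minus, plus, opp; simpl; ring).
    cbv beta in Hd.
    assert (B : ball (M := AbsRing_UniformSpace C_AbsRing) z d (z + h)%C).
    { change (Cmod (minus (z + h)%C z) < d). rewrite E. exact Hh. }
    specialize (Hd B).
    change (norm (K := C_AbsRing) (V := C_NormedModule)
      (minus (minus (f (z + h)%C) (f z)) (scal (minus (z + h)%C z) l)) <=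
       eps * Cmod (minus (z + h)%C z)) in Hd.
    rewrite E in Hd.
    replace (f (z + h) - f z - l * h)%C with (minus (minus (f (z + h)%C) (f z)) (scal h l)).
    exact Hd. unfold minus, scal, plus, opp; simpl. unfold mult; simpl. ring.
  - intros H. split.
    + apply is_linear_scal_l.
    + intros x Hx. assert (Ex := is_filter_lim_locally_unique (V := AbsRing_NormedModule C_AbsRing) _ _ Hx). subst x.
      intros eps. destruct (H eps (cond_pos eps)) as [d [Hd Hb]].
      exists (mkposreal d Hd). intros y Hy.
      change (Cmod (y - z)%C < d) in Hy.
      specialize (Hb _ Hy).
      replace (z + (y - z))%C with (y : C) in Hb by (change C in y; ring).
      change (Cmod (f y - f z - (y - z) * l)%C <= eps * Cmod (y - z)%C).
      rewrite (Cmult_comm (y - z)%C l). exact Hb.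
Qed.

(* The two normed modules have the same norm but different balls (sup norm against modulus),
   hence are not convertible. *)
Lemma is_C_derive_AbsRing (f : C -> C) (z l : C) :
  is_derive (K := C_AbsRing) (V := AbsRing_NormedModule C_AbsRing) f z l <-> Cder f z l.
Proof.
  split; intros [[Hp Hs Hn] H]; (split; [split; assumption | exact H]).
Qed.

Lemma Cder_const (a z : C) : Cder (fun _ => a) z (RtoC 0).
Proof. exact (is_derive_const a z). Qed.

Lemma Cder_id (z : C) : Cder (fun x => x) z (RtoC 1).
Proof. apply is_C_derive_AbsRing. exact (is_derive_id z). Qed.

Lemma Cder_plus (f g : C -> C) (z a b : C) :
  Cder f z a -> Cder g z b -> Cder (fun x => f x + g x)%C z (a + b)%C.
Proof. exact (@is_derive_plus C_AbsRing C_NormedModule f g z a b). Qed.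

Lemma Cder_minus (f g : C -> C) (z a b : C) :
  Cder f z a -> Cder g z b -> Cder (fun x => f x - g x)%C z (a - b)%C.
Proof. exact (@is_derive_minus C_AbsRing C_NormedModule f g z a b). Qed.

Lemma Cder_mult (f g : C -> C) (z a b : C) :
  Cder f z a -> Cder g z b -> Cder (fun x => f x * g x)%C z (a * g z + f z * b)%C.
Proof.
  rewrite <- !is_C_derive_AbsRing.
  intros Hf Hg. exact (@is_derive_mult C_AbsRing f g z a b Hf Hg Cmult_comm).
Qed.

Lemma Cder_scal (k : C) (f : C -> C) (z a : C) :
  Cder f z a -> Cder (fun x => k * f x)%C z (k * a)%C.
Proof.
  intros Hf. replace (k * a)%C with (RtoC 0 * f z + k * a)%C by ring.
  apply (Cder_mult (fun _ => k) f); auto. apply Cder_const.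
Qed.

Lemma Cder_eq (f : C -> C) (z a b : C) : Cder f z a -> a = b -> Cder f z b.
Proof. intros H <-. exact H. Qed.

Lemma Cder_comp (f g : C -> C) (z a b : C) :
  Cder f (g z) a -> Cder g z b -> Cder (fun x => f (g x)) z (b * a)%C.
Proof.
  rewrite <- (is_C_derive_AbsRing g).
  exact (@is_derive_comp C_AbsRing C_NormedModule f g z a b). Qed.

Lemma Cder_inv (z : C) : z <> RtoC 0 -> Cder (fun x => / x)%C z (- / (z * z))%C.
Proof.
  intros Hz. apply is_C_derive_eps. intros eps Heps.
  assert (Hm : 0 < Cmod z) by (apply Cmod_gt_0; auto).
  assert (H3 : 0 < Cmod z ^ 3) by (apply pow_lt; auto).
  (* The error is h^2 / (z^2 (z + h)). The first bound gives |z + h| >= |z| / 2, and then the second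
     makes |h| / (|z|^2 |z + h|) at most eps. *)
  exists (Rmin (Cmod z / 2) (eps * Cmod z ^ 3 / 2)). split.
  - apply Rmin_pos; [lra|]. apply Rdiv_lt_0_compat; [|lra]. apply Rmult_lt_0_compat; auto.
  - intros h Hh.
    assert (h1 := Rmin_l (Cmod z / 2) (eps * Cmod z ^ 3 / 2)).
    assert (h2 := Rmin_r (Cmod z / 2) (eps * Cmod z ^ 3 / 2)).
    assert (Hzh : Cmod z / 2 <= Cmod (z + h)).
    { assert (T := Cmod_triangle (z + h) (- h)).
      replace (z + h + - h)%C with z in T by ring. rewrite Cmod_opp in T. lra. }
    assert (Hnz : (z + h)%C <> RtoC 0) by (apply Cmod_gt_0; lra).
    replace (/ (z + h) - / z - - / (z * z) * h)%C with (h * h / (z * z * (z + h)))%C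
      by (field; auto).
    rewrite Cmod_div by (repeat apply Cmult_neq_0; auto).
    rewrite !Cmod_mult.
    apply Rmult_le_reg_r with (Cmod z * Cmod z * Cmod (z + h)).
    { repeat apply Rmult_lt_0_compat; lra. }
    unfold Rdiv. rewrite Rmult_assoc, Rinv_l, Rmult_1_r.
    2: { apply Rgt_not_eq. repeat apply Rmult_lt_0_compat; lra. }
    assert (P := Cmod_ge_0 h).
    assert (Cmod h <= eps * (Cmod z * Cmod z * Cmod (z + h))).
    { apply Rle_trans with (eps * Cmod z ^ 3 / 2); [lra|].
      replace (eps * Cmod z ^ 3 / 2) with (eps * (Cmod z * Cmod z * (Cmod z / 2))) by field.
      apply Rmult_le_compat_l; [lra|]. apply Rmult_le_compat_l; nra. }
    nra.
Qed.

Lemma Cder_div (f g : C -> C) (z a b : C) :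
  g z <> RtoC 0 -> Cder f z a -> Cder g z b ->
  Cder (fun x => f x / g x)%C z ((a * g z - f z * b) / (g z * g z))%C.
Proof.
  intros Hg Hf Hb.
  replace ((a * g z - f z * b) / (g z * g z))%C
    with (a * (/ g z) + f z * (b * (- / (g z * g z))))%C by (field; auto).
  apply (Cder_mult f (fun x => / g x)%C); auto.
  apply (Cder_comp (fun x => / x)%C g); auto. apply Cder_inv; auto.
Qed.

Lemma Cder_ext_loc (f g : C -> C) (z l : C) (d : R) :
  0 < d -> (forall x, Cmod (x - z) < d -> f x = g x) -> Cder f z l -> Cder g z l.
Proof.
  intros Hd H Hf. refine (is_derive_ext_loc f g z l _ Hf).
  exists (mkposreal d Hd). intros y Hy. apply H. exact Hy.
Qed.

Lemma Cder_continuity (f : C -> C) (z l : C) :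
  Cder f z l -> forall eps, 0 < eps -> exists delta, 0 < delta /\
    forall h : C, Cmod h < delta -> Cmod (f (z + h) - f z)%C < eps.
Proof.
  intros H eps Heps. rewrite is_C_derive_eps in H.
  destruct (H 1 Rlt_0_1) as [d [Hd Hb]].
  assert (Hk : 0 < 2 + Cmod l) by (assert (T := Cmod_ge_0 l); lra).
  exists (Rmin d (eps / (2 + Cmod l))). split.
  { apply Rmin_pos; auto. apply Rdiv_lt_0_compat; auto. }
  intros h Hh.
  assert (h1 := Rmin_l d (eps / (2 + Cmod l))).
  assert (h2 := Rmin_r d (eps / (2 + Cmod l))).
  specialize (Hb h ltac:(lra)).
  assert (T := Cmod_triangle (f (z + h) - f z - l * h)%C (l * h)%C).
  replace (f (z + h) - f z - l * h + l * h)%C with (f (z + h) - f z)%C in T by ring.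
  rewrite Cmod_mult in T.
  assert (Cmod h * (2 + Cmod l) < eps).
  { apply Rlt_le_trans with (eps / (2 + Cmod l) * (2 + Cmod l)).
    - apply Rmult_lt_compat_r; lra.
    - right. field. lra. }
  assert (P := Cmod_ge_0 h). lra.
Qed.

Lemma im_le_Cmod (z : C) : Rabs (Im z) <= Cmod z.
Proof. eapply Rle_trans; [apply Rmax_r | apply (Rmax_Cmod z)]. Qed.

Lemma is_derive_eps (f : R -> R) (x l : R) :
  is_derive f x l <->
  forall eps, 0 < eps -> exists delta, 0 < delta /\
    forall h, Rabs h < delta -> Rabs (f (x + h) - f x - l * h) <= eps * Rabs h.
Proof.
  split.
  - intros [_ H] eps Heps.
    destruct (H x (fun P HP => HP) (mkposreal eps Heps)) as [d Hd].
    exists d; split; [apply cond_pos|].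
    intros h Hh.
    assert (E : minus (x + h) x = h) by (unfold minus, plus, opp; simpl; ring).
    assert (B : ball x d (x + h)).
    { change (Rabs (minus (x + h) x) < d). rewrite E. exact Hh. }
    specialize (Hd _ B).
    change (Rabs (minus (minus (f (x + h)) (f x)) (scal (minus (x + h) x) l)) <=
       eps * Rabs (minus (x + h) x)) in Hd.
    rewrite E in Hd.
    replace (f (x + h) - f x - l * h) with (minus (minus (f (x + h)) (f x)) (scal h l)).
    exact Hd. unfold minus, scal, plus, opp; simpl. unfold mult; simpl. ring.
  - intros H. split.
    + apply is_linear_scal_l.
    + intros y Hy. assert (Ey := is_filter_lim_locally_unique (V := R_NormedModule) _ _ Hy). subst y. clear Hy.
      intros eps. destruct (H eps (cond_pos eps)) as [d [Hd Hb]].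
      exists (mkposreal d Hd). intros y Hy.
      change (Rabs (y - x) < d) in Hy.
      specialize (Hb _ Hy).
      replace (x + (y - x)) with (y : R) in Hb by (change R in y; ring).
      change (Rabs (f y - f x - (y - x) * l) <= eps * Rabs (y - x)).
      rewrite (Rmult_comm (y - x) l). exact Hb.
Qed.

(** All extremum arguments below are one-variable: a complex function is restricted to a line, where
    its real and imaginary parts are ordinary real functions. *)
Lemma is_derive_line (F : C -> C) (z d l : C) (t : R) :
  Cder F (z + RtoC t * d)%C l ->
  is_derive (fun s => Re (F (z + RtoC s * d)%C)) t (Re (l * d)%C) /\
  is_derive (fun s => Im (F (z + RtoC s * d)%C)) t (Im (l * d)%C).
Proof.
  intros H. rewrite is_C_derive_eps in H.
  assert (K : forall eps, 0 < eps -> exists delta, 0 < delta /\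
    forall h, Rabs h < delta ->
      Cmod (F (z + RtoC (t + h) * d) - F (z + RtoC t * d) - RtoC h * (l * d))%C <= eps * Rabs h).
  { intros eps Heps. assert (Pd := Cmod_ge_0 d).
    (* The summand 1 admits the degenerate direction d = 0. *)
    destruct (H (eps / (1 + Cmod d))) as [e [He Hb]].
    { apply Rdiv_lt_0_compat; lra. }
    exists (e / (1 + Cmod d)). split. { apply Rdiv_lt_0_compat; lra. }
    intros h Hh.
    assert (E : Cmod (RtoC h * d) = Rabs h * Cmod d) by (rewrite Cmod_mult, Cmod_R; auto).
    assert (Ph := Rabs_pos h).
    assert (Rabs h * (1 + Cmod d) < e).
    { apply Rlt_le_trans with (e / (1 + Cmod d) * (1 + Cmod d)).
      - apply Rmult_lt_compat_r; lra.
      - right. field. lra. }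
    assert (Hs : Cmod (RtoC h * d) < e) by (rewrite E; nra).
    specialize (Hb _ Hs). rewrite E in Hb.
    replace (z + RtoC (t + h) * d)%C with (z + RtoC t * d + RtoC h * d)%C
      by (rewrite RtoC_plus; ring).
    replace (RtoC h * (l * d))%C with (l * (RtoC h * d))%C by ring.
    apply (Rle_trans _ _ _ Hb).
    replace (eps / (1 + Cmod d) * (Rabs h * Cmod d)) with (eps * Rabs h * (Cmod d / (1 + Cmod d)))
      by (field; lra).
    rewrite <- (Rmult_1_r (eps * Rabs h)) at 2.
    apply Rmult_le_compat_l; [nra|].
    apply Rmult_le_reg_r with (1 + Cmod d); [lra|].
    unfold Rdiv. rewrite Rmult_assoc, Rinv_l; lra. }
  split; apply is_derive_eps; intros eps Heps; destruct (K eps Heps) as [e [He Hb]];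
    exists e; split; auto; intros h Hh; specialize (Hb h Hh);
    eapply Rle_trans; [|exact Hb| |exact Hb].
  - eapply Rle_trans; [|apply re_le_Cmod]. right. f_equal.
    generalize (F (z + RtoC (t + h) * d)%C) (F (z + RtoC t * d)%C). intros u v.
    unfold Re, Im, Cminus, Cplus, Copp, Cmult, RtoC; simpl; ring.
  - eapply Rle_trans; [|apply im_le_Cmod]. right. f_equal.
    generalize (F (z + RtoC (t + h) * d)%C) (F (z + RtoC t * d)%C). intros u v.
    unfold Re, Im, Cminus, Cplus, Copp, Cmult, RtoC; simpl; ring.
Qed.

(** * Maximum principle *)

(** One-sided on purpose: at the exit point the radial comparison holds only for t <= 0, that is,
    inside the disc |z| <= |z0|. *)
Lemma left_max_derive_ge0 (g : R -> R) (l d : R) :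
  0 < d -> is_derive g 0 l -> (forall t, - d < t <= 0 -> g t <= g 0) -> 0 <= l.
Proof.
  intros Hd H Hm. destruct (Rle_dec 0 l) as [|Hl]; auto. exfalso.
  rewrite is_derive_eps in H. destruct (H (- l / 2) ltac:(lra)) as [e [He Hb]].
  assert (h1 := Rmin_l e d). assert (h2 := Rmin_r e d).
  assert (h3 := Rmin_pos e d He Hd).
  specialize (Hb (- (Rmin e d / 2))).
  rewrite Rabs_Ropp, (Rabs_right (Rmin e d / 2)) in Hb by lra.
  specialize (Hb ltac:(lra)). specialize (Hm (- (Rmin e d / 2)) ltac:(lra)).
  rewrite Rplus_0_l in Hb. apply Rabs_le_between in Hb. nra.
Qed.

Lemma second_derivative_at_max (g g1 : R -> R) (g2 d : R) :
  0 < d -> (forall t, Rabs t < d -> is_derive g t (g1 t)) -> is_derive g1 0 g2 ->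
  (forall t, Rabs t < d -> g t <= g 0) -> g1 0 = 0 /\ g2 <= 0.
Proof.
  intros Hd H1 H2 Hm.
  assert (D0 := H1 0 ltac:(rewrite Rabs_R0; auto)).
  assert (E : g1 0 = 0).
  { apply Rle_antisym.
    - cut (0 <= - g1 0); [lra|].
      apply (left_max_derive_ge0 (fun t => g (- t)) _ d); auto.
      + assert (Dn : is_derive (fun t : R => - t) 0 (-1)) by (auto_derive; [auto | ring]).
        replace (- g1 0) with (scal (-1) (g1 0)) by (unfold scal; simpl; unfold mult; simpl; ring).
        apply (is_derive_comp g (fun t => - t)).
        * rewrite Ropp_0. exact D0.
        * exact Dn.
      + intros t Ht. rewrite Ropp_0. apply Hm. rewrite Rabs_Ropp. apply Rabs_def1; lra.
    - apply (left_max_derive_ge0 g _ d); auto.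
      intros t Ht. apply Hm. apply Rabs_def1; lra. }
  split; auto. destruct (Rle_dec g2 0) as [|Hl]; auto. exfalso.
  rewrite is_derive_eps in H2. destruct (H2 (g2 / 2) ltac:(lra)) as [e [He Hb]].
  assert (h1 := Rmin_l e d). assert (h2 := Rmin_r e d).
  assert (h3 := Rmin_pos e d He Hd). set (t := Rmin e d / 2).
  (* If g2 > 0, then g1 is positive just to the right of its zero at 0, and the mean value theorem
     gives g t > g 0. *)
  destruct (MVT_cor2 g g1 0 t) as [c [Hc1 Hc2]].
  - unfold t; lra.
  - intros c Hc. apply is_derive_Reals, H1. unfold t in Hc. apply Rabs_def1; lra.
  - specialize (Hm t). rewrite Rabs_right in Hm by (unfold t; lra).
    specialize (Hm ltac:(unfold t; lra)).
    specialize (Hb c). rewrite Rabs_right in Hb by lra.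
    specialize (Hb ltac:(unfold t in Hc2; lra)). rewrite Rplus_0_l, E in Hb.
    apply Rabs_le_between in Hb.
    assert (0 < g1 c) by nra.
    assert (0 < g1 c * (t - 0)) by (apply Rmult_lt_0_compat; lra). lra.
Qed.

Lemma Cmod_le_Rabs (z : C) : Cmod z <= Rabs (Re z) + Rabs (Im z).
Proof.
  destruct z as [x y]. simpl.
  replace (x, y) with (RtoC x + RtoC y * Ci)%C
    by (unfold RtoC, Ci, Cplus, Cmult; simpl; f_equal; ring).
  eapply Rle_trans; [apply Cmod_triangle|].
  rewrite Cmod_mult, !Cmod_R, Cmod_Ci. lra.
Qed.

(** The real Bolzano-Weierstrass theorem is used twice: along indices [phi] for which the real parts
    converge, the imaginary parts still have a cluster value. Only [k <= phi k] is asked of [phi],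
    not monotonicity. *)
Lemma bounded_cluster_point (u : nat -> C) (B : R) :
  (forall n, Cmod (u n) <= B) ->
  exists l : C, forall eps, 0 < eps -> forall N, exists n, (N <= n)%nat /\ Cmod (u n - l) < eps.
Proof.
  intros HB.
  destruct (Bolzano_Weierstrass (fun n => Re (u n)) (fun x => - B <= x <= B)) as [a Ha].
  { apply compact_P3. }
  { intros n. apply Rabs_le_between. eapply Rle_trans; [apply re_le_Cmod | apply HB]. }
  assert (Hphi : forall k, exists n, (k <= n)%nat /\ Rabs (Re (u n) - a) < / (INR k + 1)).
  { intros k. assert (Hk : 0 < / (INR k + 1)) by (apply Rinv_0_lt_compat; assert (T := pos_INR k); lra).
    destruct (Ha (disc a (mkposreal _ Hk)) k) as [n [Hn1 Hn2]].
    - exists (mkposreal _ Hk). intros x Hx. exact Hx.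
    - exists n. split; [lia | exact Hn2]. }
  pose (phi := fun k => proj1_sig (constructive_indefinite_description _ (Hphi k))).
  assert (Hphi' : forall k, (k <= phi k)%nat /\ Rabs (Re (u (phi k)) - a) < / (INR k + 1)).
  { intros k. unfold phi. destruct (constructive_indefinite_description _ (Hphi k)); auto. }
  destruct (Bolzano_Weierstrass (fun n => Im (u (phi n))) (fun x => - B <= x <= B)) as [b Hb].
  { apply compact_P3. }
  { intros n. apply Rabs_le_between. eapply Rle_trans; [apply im_le_Cmod | apply HB]. }
  exists (a, b). intros eps Heps N.
  assert (H2 : 0 < eps / 2) by lra.
  destruct (archimed_cor1 _ H2) as [K [HK1 HK2]].
  destruct (Hb (disc b (mkposreal _ H2)) (max N K)) as [k [Hk1 Hk2]].
  { exists (mkposreal _ H2). intros x Hx. exact Hx. }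
  destruct (Hphi' k) as [h1 h2].
  exists (phi k). split; [lia|].
  eapply Rle_lt_trans; [apply Cmod_le_Rabs|].
  replace (Re (u (phi k) - (a, b))%C) with (Re (u (phi k)) - a) by reflexivity.
  replace (Im (u (phi k) - (a, b))%C) with (Im (u (phi k)) - b) by reflexivity.
  unfold disc in Hk2; simpl in Hk2.
  assert (/ (INR k + 1) < eps / 2); [|lra].
  eapply Rle_lt_trans; [|exact HK1].
  apply Rinv_le_contravar. { apply lt_0_INR; auto. }
  assert (INR K <= INR k) by (apply le_INR; lia). lra.
Qed.

Notation Ccontinuous := (continuous (T := C_UniformSpace) (U := R_UniformSpace)).

Lemma Ccontinuous_eps (f : C -> R) (z : C) :
  Ccontinuous f z -> forall eps, 0 < eps -> exists delta, 0 < delta /\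
    forall h : C, Cmod h < delta -> Rabs (f (z + h)%C - f z) < eps.
Proof.
  intros H eps Heps.
  destruct (H (fun x => Rabs (x - f z) < eps)) as [d Hd].
  { exists (mkposreal eps Heps). intros y Hy. exact Hy. }
  exists d. split; [apply cond_pos|]. intros h Hh. apply Hd.
  assert (h1 := re_le_Cmod h). assert (h2 := im_le_Cmod h).
  split.
  - change (Rabs (Re z + Re h - Re z) < d). replace (Re z + Re h - Re z) with (Re h) by ring. lra.
  - change (Rabs (Im z + Im h - Im z) < d). replace (Im z + Im h - Im z) with (Im h) by ring. lra.
Qed.

Lemma Cder_Ccontinuous (f : C -> C) (z l : C) :
  Cder f z l -> continuous (T := C_UniformSpace) (U := C_UniformSpace) f z.
Proof.
  intros H P [e He].
  destruct (Cder_continuity f z l H e (cond_pos e)) as [d [Hd Hb]].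
  assert (Hd2 : 0 < d / 2) by lra.
  exists (mkposreal _ Hd2). intros y [Hy1 Hy2].
  change (Rabs (Re y - Re z) < d / 2) in Hy1. change (Rabs (Im y - Im z) < d / 2) in Hy2.
  apply He. specialize (Hb (y - z)%C).
  replace (z + (y - z))%C with (y : C) in Hb by (change C in y; ring).
  assert (B : Cmod (y - z)%C < d).
  { eapply Rle_lt_trans; [apply Cmod_le_Rabs|].
    change (Rabs (Re y - Re z) + Rabs (Im y - Im z) < d). lra. }
  specialize (Hb B).
  assert (h1 := re_le_Cmod (f y - f z)%C). assert (h2 := im_le_Cmod (f y - f z)%C).
  split.
  - change (Rabs (Re (f y - f z)%C) < e). lra.
  - change (Rabs (Im (f y - f z)%C) < e). lra.
Qed.

Lemma Ccontinuous_Re (z : C) : Ccontinuous Re z.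
Proof. destruct z as [x y]. exact (continuous_fst (U := R_UniformSpace) (V := R_UniformSpace) x y). Qed.

Lemma Ccontinuous_Im (z : C) : Ccontinuous Im z.
Proof. destruct z as [x y]. exact (continuous_snd (U := R_UniformSpace) (V := R_UniformSpace) x y). Qed.

Lemma Ccontinuous_plus (f g : C -> R) (z : C) :
  Ccontinuous f z -> Ccontinuous g z -> Ccontinuous (fun x => f x + g x) z.
Proof. exact (@continuous_plus C_UniformSpace R_AbsRing R_NormedModule f g z). Qed.

Lemma Ccontinuous_mult (f g : C -> R) (z : C) :
  Ccontinuous f z -> Ccontinuous g z -> Ccontinuous (fun x => f x * g x) z.
Proof. exact (@continuous_mult C_UniformSpace R_AbsRing f g z). Qed.

Lemma Ccontinuous_const (a : R) (z : C) : Ccontinuous (fun _ => a) z.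
Proof. apply continuous_const. Qed.

Lemma Ccontinuous_scal (a : R) (f : C -> R) (z : C) :
  Ccontinuous f z -> Ccontinuous (fun x => a * f x) z.
Proof. apply Ccontinuous_mult, Ccontinuous_const. Qed.

Lemma Ccontinuous_sqr (f : C -> R) (z : C) :
  Ccontinuous f z -> Ccontinuous (fun x => f x ^ 2) z.
Proof.
  intros H. simpl. apply Ccontinuous_mult, Ccontinuous_mult; auto. apply Ccontinuous_const.
Qed.

Lemma Ccontinuous_comp_R (g : R -> R) (f : C -> R) (z : C) :
  Ccontinuous f z -> continuous g (f z) -> Ccontinuous (fun x => g (f x)) z.
Proof. exact (@continuous_comp C_UniformSpace R_UniformSpace R_UniformSpace f g z). Qed.

Lemma Ccontinuous_comp (f : C -> C) (g : C -> R) (z l : C) :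
  Cder f z l -> Ccontinuous g (f z) -> Ccontinuous (fun x => g (f x)) z.
Proof.
  intros Hf. apply Cder_Ccontinuous in Hf.
  exact (@continuous_comp C_UniformSpace C_UniformSpace R_UniformSpace f g z Hf).
Qed.

Lemma Ccontinuous_Cmod (z : C) : Ccontinuous Cmod z.
Proof.
  apply (Ccontinuous_comp_R sqrt (fun z : C => Re z ^ 2 + Im z ^ 2)).
  - apply Ccontinuous_plus; apply Ccontinuous_sqr; [apply Ccontinuous_Re | apply Ccontinuous_Im].
  - apply continuous_sqrt.
Qed.

(** A cluster point of a maximizing sequence lies in the closed set [K], and upper semicontinuity
    gives it the supremum as value. This serves both for the maximum on a rectangle and, with
    [- Cmod], for the exit point of smallest modulus. *)
Lemma bounded_closed_max (K : C -> Prop) (f : C -> R) (B M : R) :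
  (exists z, K z) -> (forall z, K z -> Cmod z <= B) -> (forall z, K z -> f z <= M) ->
  (forall z, ~ K z -> exists d, 0 < d /\ forall h : C, Cmod h < d -> ~ K (z + h)%C) ->
  (forall z, K z -> forall eps, 0 < eps ->
     exists d, 0 < d /\ forall h : C, Cmod h < d -> K (z + h)%C -> f (z + h)%C < f z + eps) ->
  exists z, K z /\ forall z', K z' -> f z' <= f z.
Proof.
  intros [z0 Hz0] HB HM Hcl Hc.
  destruct (completeness (fun x => exists z, K z /\ x = f z)) as [S [HS1 HS2]].
  { exists M. intros x [z [Hz ->]]. auto. }
  { exists (f z0), z0; auto. }
  assert (Hu : forall n : nat, exists z, K z /\ S - / (INR n + 1) < f z).
  { intros n. apply NNPP. intros Hn.
    assert (T : 0 < / (INR n + 1)) by (apply Rinv_0_lt_compat; assert (T := pos_INR n); lra).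
    cut (S <= S - / (INR n + 1)); [lra|].
    apply HS2. intros x [z [Hz ->]]. apply Rnot_lt_le. intros Hlt. apply Hn. exists z; auto. }
  pose (u := fun k => proj1_sig (constructive_indefinite_description _ (Hu k))).
  assert (Hu' : forall k, K (u k) /\ S - / (INR k + 1) < f (u k)).
  { intros k. unfold u. destruct (constructive_indefinite_description _ (Hu k)); auto. }
  destruct (bounded_cluster_point u B) as [l Hl].
  { intros n. apply HB, Hu'. }
  assert (Kl : K l).
  { apply NNPP. intros Hn. destruct (Hcl l Hn) as [d [Hd Hd']].
    destruct (Hl d Hd 0%nat) as [n [_ Hn']]. apply (Hd' _ Hn').
    replace (l + (u n - l))%C with (u n) by ring. apply Hu'. }
  exists l. split; auto. intros z' Hz'.
  apply Rle_trans with S. { apply HS1. exists z'; auto. }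
  apply Rnot_lt_le. intros Hlt.
  assert (He : 0 < (S - f l) / 2) by lra.
  destruct (Hc l Kl _ He) as [d [Hd Hd']].
  destruct (archimed_cor1 _ He) as [N [HN1 HN2]].
  destruct (Hl d Hd N) as [n [Hn1 Hn2]].
  specialize (Hd' _ Hn2). replace (l + (u n - l))%C with (u n) in Hd' by ring.
  destruct (Hu' n) as [h1 h2]. specialize (Hd' h1).
  assert (/ (INR n + 1) <= / INR N).
  { apply Rinv_le_contravar. { apply lt_0_INR; auto. }
    assert (INR N <= INR n) by (apply le_INR; lia). lra. }
  lra.
Qed.

(** The test function of the maximum principle along a line, with [a] and [b] standing for the real
    and imaginary parts of f. The next lemma differentiates the result once more. *)
Lemma is_derive_sq_plus_sq (a b : R -> R) (t a1 b1 delta eta x y dx dy : R) :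
  is_derive a t a1 -> is_derive b t b1 ->
  is_derive (fun s => a s ^ 2 + b s ^ 2 + delta * (x + s * dx)
     - eta * (y + s * dy) ^ 2 + 2 * eta * (x + s * dx) ^ 2) t
    (2 * (a t * a1 + b t * b1) + delta * dx - 2 * eta * dy * (y + t * dy)
      + 4 * eta * dx * (x + t * dx)).
Proof.
  intros Ha Hb. auto_derive.
  - repeat split; eexists; eassumption.
  - rewrite (is_derive_unique (fun s : R => a s) _ _ Ha), (is_derive_unique (fun s : R => b s) _ _ Hb). ring.
Qed.

Lemma is_derive_dot (a b a1 b1 : R -> R) (t da db da1 db1 delta eta x y dx dy : R) :
  is_derive a t da -> is_derive b t db -> is_derive a1 t da1 -> is_derive b1 t db1 ->
  is_derive (fun s => 2 * (a s * a1 s + b s * b1 s) + delta * dx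
     - 2 * eta * dy * (y + s * dy) + 4 * eta * dx * (x + s * dx)) t
    (2 * (da * a1 t + db * b1 t) + 2 * (a t * da1 + b t * db1)
      + eta * (4 * dx ^ 2 - 2 * dy ^ 2)).
Proof.
  intros Ha Hb Ha1 Hb1. auto_derive.
  - repeat split; eexists; eassumption.
  - rewrite (is_derive_unique (fun s : R => a s) _ _ Ha), (is_derive_unique (fun s : R => b s) _ _ Hb),
      (is_derive_unique (fun s : R => a1 s) _ _ Ha1), (is_derive_unique (fun s : R => b1 s) _ _ Hb1). ring.
Qed.

(** Stated for a single direction [d]: the Laplacian appears when the inequalities for d = 1 and d =
    i are added. The linear term in [delta] leaves no trace in the second derivative. *)
Lemma second_variation_at_max (f f1 : C -> C) (z d f2 : C) (delta eta r : R) :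
  0 < r ->
  (forall t, Rabs t < r -> Cder f (z + RtoC t * d)%C (f1 (z + RtoC t * d)%C)) ->
  Cder f1 z f2 ->
  let H x := Cmod (f x) ^ 2 + delta * Re x - eta * Im x ^ 2 + 2 * eta * Re x ^ 2 in
  (forall t, Rabs t < r -> H (z + RtoC t * d)%C <= H z) ->
  2 * (Re (f1 z * d)%C ^ 2 + Im (f1 z * d)%C ^ 2)
  + 2 * (Re (f z) * Re (f2 * d * d)%C + Im (f z) * Im (f2 * d * d)%C)
  + eta * (4 * Re d ^ 2 - 2 * Im d ^ 2) <= 0.
Proof.
  intros Hr D1 D2 H Hm.
  pose (L := fun s : R => (z + RtoC s * d)%C).
  assert (L0 : L 0 = z) by (unfold L; ring).
  pose (g := fun s => Re (f (L s)) ^ 2 + Im (f (L s)) ^ 2 + delta * (Re z + s * Re d)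
     - eta * (Im z + s * Im d) ^ 2 + 2 * eta * (Re z + s * Re d) ^ 2).
  pose (g1 := fun s => 2 * (Re (f (L s)) * Re (f1 (L s) * d)%C + Im (f (L s)) * Im (f1 (L s) * d)%C)
     + delta * Re d - 2 * eta * Im d * (Im z + s * Im d) + 4 * eta * Re d * (Re z + s * Re d)).
  assert (ReL : forall s, Re (L s) = Re z + s * Re d)
    by (intros; unfold L, Re, RtoC; simpl; ring).
  assert (ImL : forall s, Im (L s) = Im z + s * Im d)
    by (intros; unfold L, Im, RtoC; simpl; ring).
  assert (E : forall s, H (L s) = g s).
  { intros s. unfold H, g. rewrite Cmod2_alt, ReL, ImL. reflexivity. }
  assert (D3 : Cder (fun x => f1 x * d)%C (z + RtoC 0 * d)%C (f2 * d)%C).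
  { replace (f2 * d)%C with (f2 * d + f1 z * RtoC 0)%C by ring.
    replace (z + RtoC 0 * d)%C with z by ring.
    apply Cder_mult; auto. apply Cder_const. }
  assert (D4 := D1 0 ltac:(rewrite Rabs_R0; auto)).
  apply is_derive_line in D3. apply is_derive_line in D4.
  destruct D3 as [D3r D3i]. destruct D4 as [D4r D4i].
  replace (z + RtoC 0 * d)%C with z in D4r, D4i by ring.
  destruct (second_derivative_at_max g g1
    (2 * (Re (f1 z * d)%C ^ 2 + Im (f1 z * d)%C ^ 2)
      + 2 * (Re (f z) * Re (f2 * d * d)%C + Im (f z) * Im (f2 * d * d)%C)
      + eta * (4 * Re d ^ 2 - 2 * Im d ^ 2)) r); auto.
  - intros t Ht. specialize (D1 t Ht). apply is_derive_line in D1. destruct D1 as [Da Db].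
    apply (is_derive_sq_plus_sq _ _ _ _ _ delta eta (Re z) (Im z) (Re d) (Im d) Da Db).
  - assert (T := is_derive_dot _ _ _ _ _ _ _ _ _ delta eta (Re z) (Im z) (Re d) (Im d)
      D4r D4i D3r D3i).
    cbv beta in T.
    replace (z + RtoC 0 * d)%C with z in T by ring.
    replace (Re (f1 z * d)%C ^ 2 + Im (f1 z * d)%C ^ 2) with
      (Re (f1 z * d)%C * Re (f1 z * d)%C + Im (f1 z * d)%C * Im (f1 z * d)%C) by ring.
    exact T.
  - intros t Ht. rewrite <- !E. rewrite L0. apply Hm; auto.
Qed.

(* Phragmen-Lindeloef in the half-plane: [|f|^2 + delta Re z + eta (2 (Re z)^2 - (Im z)^2)]
   has positive Laplacian, so on a large rectangle it is maximal on the boundary. *)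
Lemma half_plane_max_principle (f f1 : C -> C) (M : R) :
  (forall z, Re z <= 0 -> Cder f z (f1 z)) ->
  (forall z, Re z < 0 -> exists l : C, Cder f1 z l) ->
  (forall z, Re z <= 0 -> Cmod (f z) <= M) ->
  (forall z, Re z = 0 -> Cmod (f z) <= 1) ->
  forall z, Re z <= 0 -> Cmod (f z) <= 1.
Proof.
  intros D1 D2 HM H1.
  assert (M0 : 0 <= M).
  { eapply Rle_trans; [apply (Cmod_ge_0 (f (RtoC 0)))|apply HM; simpl; lra]. }
  assert (Sq : forall z, Re z <= 0 -> Cmod (f z) ^ 2 <= M ^ 2).
  { intros z Hz. apply pow_incr. split; [apply Cmod_ge_0 | auto]. }
  assert (Main : forall z delta, Re z <= 0 -> 0 < delta ->
    Cmod (f z) ^ 2 <= 1 + delta * (Im z ^ 2 - Re z)).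
  { intros z0 delta Hz0 Hd.
    (* The constants make H <= 1 on each side of the rectangle. On Re z = -A, half of delta A
       absorbs M^2 and the other half absorbs 2 eta A^2, because eta A = delta / 4. On |Im z| = B,
       the term eta B^2 absorbs M^2 + 2 eta A^2. On Re z = 0 the bound is the hypothesis on |f|. The
       remaining summands put z0 inside. *)
    pose (A := 1 - Re z0 + 2 * M ^ 2 / delta).
    assert (Hq : 0 <= M ^ 2 / delta).
    { apply Rmult_le_pos; [nra | apply Rlt_le, Rinv_0_lt_compat; auto]. }
    assert (HA : 1 <= A) by (unfold A; lra).
    assert (HA0 : - A <= Re z0) by (unfold A; lra).
    assert (HAM : M ^ 2 <= delta * A / 2).
    { replace (M ^ 2) with (delta * (M ^ 2 / delta)) by (field; lra).
      unfold A. nra. }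
    pose (eta := delta / (4 * A)).
    assert (He : 0 < eta) by (unfold eta; apply Rdiv_lt_0_compat; lra).
    assert (HeA : eta * A = delta / 4) by (unfold eta; field; lra).
    pose (B := 1 + Rabs (Im z0) + (M ^ 2 + 2 * eta * A ^ 2) / eta).
    assert (Hq2 : 0 <= (M ^ 2 + 2 * eta * A ^ 2) / eta).
    { apply Rmult_le_pos; [nra | apply Rlt_le, Rinv_0_lt_compat; auto]. }
    assert (HB1 : 1 <= B) by (unfold B; assert (T := Rabs_pos (Im z0)); lra).
    assert (HB0 : Rabs (Im z0) <= B) by (unfold B; lra).
    assert (HBM : M ^ 2 + 2 * eta * A ^ 2 <= eta * B ^ 2).
    { apply Rle_trans with (eta * B).
      - replace (M ^ 2 + 2 * eta * A ^ 2) with (eta * ((M ^ 2 + 2 * eta * A ^ 2) / eta))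
          by (field; lra).
        apply Rmult_le_compat_l; [lra|]. unfold B. assert (T := Rabs_pos (Im z0)); lra.
      - apply Rmult_le_compat_l; [lra|]. nra. }
    pose (H := fun x => Cmod (f x) ^ 2 + delta * Re x - eta * Im x ^ 2 + 2 * eta * Re x ^ 2).
    pose (K := fun z => - A <= Re z <= 0 /\ Rabs (Im z) <= B).
    destruct (bounded_closed_max K H (A + B) (M ^ 2 + 2 * eta * A ^ 2)) as [m [Km Hm]].
    - exists z0. split; auto.
    - intros z [Hz1 Hz2]. eapply Rle_trans; [apply Cmod_le_Rabs|].
      assert (Rabs (Re z) <= A) by (apply Rabs_le; lra). lra.
    - intros z [Hz1 Hz2]. unfold H. assert (S := Sq z ltac:(lra)).
      assert (0 <= eta * Im z ^ 2) by nra.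
      assert (eta * Re z ^ 2 <= eta * A ^ 2) by (apply Rmult_le_compat_l; [lra | nra]).
      nra.
    - intros z Hz.
      assert (Hz' : 0 < Rmax (Rmax (- A - Re z) (Re z)) (Rabs (Im z) - B)).
      { apply Rnot_le_lt. intros Hle. apply Hz.
        assert (t1 := Rmax_l (Rmax (- A - Re z) (Re z)) (Rabs (Im z) - B)).
        assert (t2 := Rmax_r (Rmax (- A - Re z) (Re z)) (Rabs (Im z) - B)).
        assert (t3 := Rmax_l (- A - Re z) (Re z)). assert (t4 := Rmax_r (- A - Re z) (Re z)).
        split; lra. }
      eexists. split; [exact Hz'|]. intros h Hh [Kh1 Kh2].
      assert (E1 := re_le_Cmod h). assert (E2 := im_le_Cmod h).
      change (Re (z + h)%C) with (Re z + Re h) in Kh1.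
      assert (Kh3 := Rabs_triang (Im (z + h)%C) (- Im h)). rewrite Rabs_Ropp in Kh3.
      replace (Im (z + h)%C + - Im h) with (Im z) in Kh3
        by (change (Im (z + h)%C) with (Im z + Im h); ring).
      apply Rabs_le_between in E1.
      revert Hh. apply Rle_not_lt.
      apply Rmax_lub; [apply Rmax_lub|]; lra.
    - intros z [Hz _] eps Heps.
      assert (Cz : Ccontinuous H z).
      { apply Ccontinuous_plus; [apply Ccontinuous_plus; [apply Ccontinuous_plus|]|].
        - apply Ccontinuous_sqr. apply (Ccontinuous_comp f Cmod z (f1 z)).
          + apply D1; lra.
          + apply Ccontinuous_Cmod.
        - apply Ccontinuous_scal, Ccontinuous_Re.
        - apply (Ccontinuous_comp_R Ropp (fun x => eta * Im x ^ 2)).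
          + apply Ccontinuous_scal, Ccontinuous_sqr, Ccontinuous_Im.
          + apply (continuous_opp (V := R_NormedModule) (fun x : R => x)), continuous_id.
        - apply Ccontinuous_scal, Ccontinuous_sqr, Ccontinuous_Re. }
      destruct (Ccontinuous_eps _ _ Cz eps Heps) as [d [Hdp Hd']].
      exists d. split; auto. intros h Hh _. specialize (Hd' h Hh). apply Rabs_def2 in Hd'. lra.
    - assert (Hb : H m <= 1).
      { destruct Km as [[Km1 Km2] Km3].
        assert (S := Sq m Km2). assert (T := Cmod_ge_0 (f m)).
        destruct (Rle_lt_or_eq_dec _ _ Km2) as [K2|K2].
        2:{ specialize (H1 m K2). unfold H. rewrite K2. nra. }
        destruct (Rle_lt_or_eq_dec _ _ Km1) as [K1|K1].
        2:{ unfold H. rewrite <- K1.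
            replace (2 * eta * (- A) ^ 2) with (2 * (eta * A) * A) by ring.
            rewrite HeA. assert (0 <= eta * Im m ^ 2) by nra. lra. }
        destruct (Rle_lt_or_eq_dec _ _ Km3) as [K3|K3].
        2:{ unfold H. rewrite <- (pow2_abs (Im m)), K3.
            assert (eta * Re m ^ 2 <= eta * A ^ 2) by (apply Rmult_le_compat_l; [lra | nra]).
            nra. }
        exfalso. destruct (D2 m K2) as [f2 Hf2].
        pose (r := Rmin (Rmin (- Re m) (Re m + A)) (B - Rabs (Im m))).
        assert (r1 : r <= - Re m) by (unfold r; eapply Rle_trans; [apply Rmin_l | apply Rmin_l]).
        assert (r2 : r <= Re m + A) by (unfold r; eapply Rle_trans; [apply Rmin_l | apply Rmin_r]).
        assert (r3 : r <= B - Rabs (Im m)) by (unfold r; apply Rmin_r).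
        assert (Hr : 0 < r) by (unfold r; repeat apply Rmin_pos; lra).
        assert (Loc : forall d : C, Cmod d = 1 -> forall t, Rabs t < r -> K (m + RtoC t * d)%C).
        { intros d Hd1 t Ht.
          assert (E : Cmod (RtoC t * d) < r) by (rewrite Cmod_mult, Cmod_R, Hd1; lra).
          assert (E1 := re_le_Cmod (RtoC t * d)). assert (E2 := im_le_Cmod (RtoC t * d)).
          assert (E3 : Rabs (Re (RtoC t * d)%C) < r) by lra. apply Rabs_def2 in E3.
          assert (E4 : Rabs (Im (m + RtoC t * d)%C) <= Rabs (Im m) + Rabs (Im (RtoC t * d)%C))
            by apply Rabs_triang.
          split; [|lra].
          replace (Re (m + RtoC t * d)%C) with (Re m + Re (RtoC t * d)%C) by reflexivity. lra. }
        assert (V : forall d : C, Cmod d = 1 ->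
          2 * (Re (f1 m * d)%C ^ 2 + Im (f1 m * d)%C ^ 2)
          + 2 * (Re (f m) * Re (f2 * d * d)%C + Im (f m) * Im (f2 * d * d)%C)
          + eta * (4 * Re d ^ 2 - 2 * Im d ^ 2) <= 0).
        { intros d Hd1. apply (second_variation_at_max f f1 m d f2 delta eta r); auto.
          - intros t Ht. apply D1. apply (Loc d Hd1 t Ht).
          - intros t Ht. apply Hm. apply (Loc d Hd1 t Ht). }
        (* The terms in [f2] cancel since i^2 = -1, and the sum reads 4 |f1 m|^2 + 2 eta <= 0, which
           is absurd. *)
        assert (V1 := V (RtoC 1) Cmod_1). assert (V2 := V Ci Cmod_Ci).
        replace (f2 * RtoC 1 * RtoC 1)%C with f2 in V1 by ring.
        replace (f2 * Ci * Ci)%C with (- f2)%C in V2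
          by (unfold Ci, Cmult, Copp; simpl; f_equal; ring).
        replace (Re (- f2)%C) with (- Re f2) in V2 by reflexivity.
        replace (Im (- f2)%C) with (- Im f2) in V2 by reflexivity.
        replace (Re (RtoC 1)) with 1 in V1 by reflexivity.
        replace (Im (RtoC 1)) with 0 in V1 by reflexivity.
        replace (Re Ci) with 0 in V2 by reflexivity.
        replace (Im Ci) with 1 in V2 by reflexivity.
        nra. }
      specialize (Hm z0 (conj (conj HA0 Hz0) HB0)).
      assert (P : H z0 <= 1) by lra. unfold H in P.
      assert (Hed : eta <= delta) by nra.
      assert (eta * Im z0 ^ 2 <= delta * Im z0 ^ 2) by (apply Rmult_le_compat_r; nra).
      assert (0 <= eta * Re z0 ^ 2) by nra. lra. }
  intros z Hz.
  apply Rnot_lt_le. intros Hlt.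
  (* In place of the limit delta -> 0, one value is inserted in [Main]: |f|^2 - 1 divided by Im^2 -
     Re + 1. The added 1 makes the denominator positive and the resulting inequality
     contradictory. *)
  assert (Hp : 0 < Im z ^ 2 - Re z + 1) by nra.
  assert (Hq : 0 < (Cmod (f z) ^ 2 - 1) / (Im z ^ 2 - Re z + 1))
    by (apply Rdiv_lt_0_compat; nra).
  specialize (Main z _ Hz Hq).
  assert (E : (Cmod (f z) ^ 2 - 1) / (Im z ^ 2 - Re z + 1) * (Im z ^ 2 - Re z + 1)
    = Cmod (f z) ^ 2 - 1) by (field; lra).
  nra.
Qed.

(** * Exponential and logarithm *)

Lemma Cexp_0 : Cexp (RtoC 0) = RtoC 1.
Proof.
  unfold Cexp; simpl. rewrite exp_0, cos_0, sin_0. unfold RtoC. f_equal; ring.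
Qed.

Lemma Cexp_plus (a b : C) : Cexp (a + b) = (Cexp a * Cexp b)%C.
Proof.
  destruct a as [a a'], b as [b b']. unfold Cexp, Cplus, Cmult; simpl.
  rewrite exp_plus, cos_plus, sin_plus. f_equal; ring.
Qed.

Lemma Cmod_Cexp (a : C) : Cmod (Cexp a) = exp (Re a).
Proof.
  unfold Cexp, Cmod; simpl.
  replace (_ + _) with (exp (Re a) ^ 2).
  - apply sqrt_pow2. apply Rlt_le, exp_pos.
  - assert (T := sin2_cos2 (Im a)). unfold Rsqr in T.
    replace (exp (Re a) ^ 2) with
      (exp (Re a) ^ 2 * (sin (Im a) * sin (Im a) + cos (Im a) * cos (Im a))) by (rewrite T; ring).
    ring.
Qed.

Lemma Cexp_near_0 (eps : R) : 0 < eps -> exists delta, 0 < delta /\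
  forall k : C, Cmod k < delta -> Cmod (Cexp k - RtoC 1 - k)%C <= eps * Cmod k.
Proof.
  intros Heps.
  assert (De : is_derive exp 0 1) by (auto_derive; [auto | rewrite exp_0; ring]).
  assert (Dc : is_derive cos 0 0) by (auto_derive; [auto | rewrite sin_0; ring]).
  assert (Ds : is_derive sin 0 1) by (auto_derive; [auto | rewrite cos_0; ring]).
  rewrite is_derive_eps in De, Dc, Ds.
  (* The real part costs 3 e |k| and the imaginary part 5 e |k|, hence the 8; the bound e <= 1 tames
     the mixed products. *)
  pose (e := Rmin 1 (eps / 8)).
  assert (He : 0 < e) by (unfold e; apply Rmin_pos; lra).
  assert (He1 : e <= 1) by apply Rmin_l.
  assert (He2 : e <= eps / 8) by apply Rmin_r. clearbody e.
  destruct (De e He) as [d1 [Hd1 P1]]. destruct (Dc e He) as [d2 [Hd2 P2]].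
  destruct (Ds e He) as [d3 [Hd3 P3]].
  exists (Rmin e (Rmin d1 (Rmin d2 d3))).
  split. { repeat apply Rmin_pos; auto. }
  intros k Hk.
  assert (k0 : Cmod k < e) by (eapply Rlt_le_trans; [exact Hk | apply Rmin_l]).
  assert (k' : Cmod k < Rmin d1 (Rmin d2 d3)) by (eapply Rlt_le_trans; [exact Hk | apply Rmin_r]).
  assert (k1 : Cmod k < d1) by (eapply Rlt_le_trans; [exact k' | apply Rmin_l]).
  assert (k'' : Cmod k < Rmin d2 d3) by (eapply Rlt_le_trans; [exact k' | apply Rmin_r]).
  assert (k2 : Cmod k < d2) by (eapply Rlt_le_trans; [exact k'' | apply Rmin_l]).
  assert (k3 : Cmod k < d3) by (eapply Rlt_le_trans; [exact k'' | apply Rmin_r]).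
  assert (E1 := re_le_Cmod k). assert (E2 := im_le_Cmod k).
  specialize (P1 (Re k) ltac:(lra)). specialize (P2 (Im k) ltac:(lra)).
  specialize (P3 (Im k) ltac:(lra)).
  rewrite !Rplus_0_l in P1, P2, P3.
  rewrite exp_0 in P1. rewrite cos_0 in P2. rewrite sin_0 in P3.
  eapply Rle_trans; [apply Cmod_le_Rabs|].
  destruct k as [x y]. unfold Cexp. simpl Re in *; simpl Im in *.
  unfold Re, Im, Cminus, Cplus, Copp, RtoC; simpl fst; simpl snd.
  set (m := Cmod (x, y)) in *. assert (Hm := Cmod_ge_0 (x, y)). fold m in Hm.
  assert (Bc : Rabs (cos y) <= 1) by (apply Rabs_le; assert (T := COS_bound y); lra).
  assert (Bs : Rabs (sin y) <= 1) by (apply Rabs_le; assert (T := SIN_bound y); lra).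
  assert (F1 : Rabs (exp x * cos y + - (1) + - x) <= 3 * e * m).
  { replace (exp x * cos y + - (1) + - x) with
      ((exp x - 1 - 1 * x) * cos y + (1 + x) * (cos y - 1 - 0 * y)) by ring.
    eapply Rle_trans; [apply Rabs_triang|]. rewrite !Rabs_mult.
    assert (Rabs (1 + x) <= 2).
    { eapply Rle_trans; [apply Rabs_triang|]. rewrite Rabs_R1. lra. }
    assert (a1 := Rabs_pos (exp x - 1 - 1 * x)). assert (a2 := Rabs_pos (cos y - 1 - 0 * y)).
    assert (a3 := Rabs_pos (cos y)). assert (a4 := Rabs_pos (1 + x)).
    assert (e * Rabs x <= e * m) by (apply Rmult_le_compat_l; lra).
    assert (e * Rabs y <= e * m) by (apply Rmult_le_compat_l; lra).
    nra. }
  assert (F2 : Rabs (exp x * sin y + - 0 + - y) <= 5 * e * m).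
  { replace (exp x * sin y + - 0 + - y) with
      ((exp x - 1 - 1 * x) * sin y + x * sin y + (sin y - 0 - 1 * y)) by ring.
    eapply Rle_trans; [apply Rabs_triang|].
    eapply Rle_trans; [apply Rplus_le_compat_r, Rabs_triang|]. rewrite !Rabs_mult.
    assert (a1 := Rabs_pos (exp x - 1 - 1 * x)). assert (a2 := Rabs_pos (sin y - 0 - 1 * y)).
    assert (a3 := Rabs_pos (sin y)). assert (a4 := Rabs_pos x).
    assert (Hs : Rabs (sin y) <= 2 * m).
    { replace (sin y) with ((sin y - 0 - 1 * y) + y) by ring.
      eapply Rle_trans; [apply Rabs_triang|]. assert (b := Rabs_pos y). nra. }
    assert (e * Rabs x <= e * m) by (apply Rmult_le_compat_l; lra).
    assert (e * Rabs y <= e * m) by (apply Rmult_le_compat_l; lra).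
    assert (Rabs x * Rabs (sin y) <= e * (2 * m)) by (apply Rmult_le_compat; lra).
    nra. }
  assert (e * m <= eps / 8 * m) by (apply Rmult_le_compat_r; lra). lra.
Qed.

Lemma Cder_Cexp (z : C) : Cder Cexp z (Cexp z).
Proof.
  apply is_C_derive_eps. intros eps Heps.
  assert (Hz := exp_pos (Re z)).
  destruct (Cexp_near_0 (eps / exp (Re z))) as [d [Hd Hb]].
  { apply Rdiv_lt_0_compat; auto. }
  exists d. split; auto. intros h Hh. rewrite Cexp_plus.
  replace (Cexp z * Cexp h - Cexp z - Cexp z * h)%C
    with (Cexp z * (Cexp h - RtoC 1 - h))%C by ring.
  rewrite Cmod_mult, Cmod_Cexp.
  eapply Rle_trans; [apply Rmult_le_compat_l; [lra | apply Hb, Hh]|].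
  right. field. lra.
Qed.

(* The logarithm on the plane slit along the nonpositive real axis, which is the set
   [0 < Cmod z + Re z]; the half-angle formula makes the argument manifestly continuous there. *)
Definition slit_log (z : C) : C := (ln (Cmod z), 2 * atan (Im z / (Cmod z + Re z))).

Lemma slit_neq_0 (z : C) : 0 < Cmod z + Re z -> z <> RtoC 0.
Proof. intros H ->. rewrite Cmod_0 in H. simpl in H. lra. Qed.

Lemma Cexp_slit_log (z : C) : 0 < Cmod z + Re z -> Cexp (slit_log z) = z.
Proof.
  intros H. assert (Hz := slit_neq_0 z H). apply Cmod_gt_0 in Hz.
  unfold Cexp, slit_log. simpl. rewrite exp_ln by auto.
  set (r := Cmod z) in *. set (t := Im z / (r + Re z)).
  assert (Hr : r ^ 2 = Re z ^ 2 + Im z ^ 2) by (unfold r; apply Cmod2_alt).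
  assert (Ht : 0 < 1 + t ^ 2) by nra.
  (* Here t is the tangent of half the argument; this identity turns the double-angle formulas into
     Re z / r and Im z / r. *)
  assert (Et : 1 + t ^ 2 = 2 * r / (r + Re z)).
  { unfold t. apply Rmult_eq_reg_r with ((r + Re z) ^ 2); [|nra]. field_simplify; nra. }
  assert (Hc := cos_atan t). assert (Hs := sin_atan t).
  assert (S2 : sqrt (1 + t²) ^ 2 = 1 + t ^ 2).
  { rewrite pow2_sqrt; unfold Rsqr; nra. }
  assert (S0 : 0 < sqrt (1 + t²)) by (apply sqrt_lt_R0; unfold Rsqr; nra).
  rewrite cos_2a, sin_2a, Hc, Hs.
  set (q := sqrt (1 + t²)) in *.
  assert (Z1 : r * (1 / q * (1 / q) - t / q * (t / q)) = Re z).
  { replace (1 / q * (1 / q) - t / q * (t / q)) with ((2 - (1 + t ^ 2)) / q ^ 2)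
      by (field; lra).
    rewrite S2, Et. field. split; lra. }
  assert (Z2 : r * (2 * (t / q) * (1 / q)) = Im z).
  { replace (2 * (t / q) * (1 / q)) with (2 * t / (1 + t ^ 2))
      by (rewrite <- S2; field; lra).
    rewrite Et. unfold t. field. split; lra. }
  rewrite Z1, Z2. destruct z; reflexivity.
Qed.

Lemma slit_log_continuous (z : C) : 0 < Cmod z + Re z ->
  Ccontinuous (fun x => Re (slit_log x)) z /\ Ccontinuous (fun x => Im (slit_log x)) z.
Proof.
  intros H. assert (Hz := slit_neq_0 z H). apply Cmod_gt_0 in Hz.
  split.
  - apply (Ccontinuous_comp_R ln Cmod). apply Ccontinuous_Cmod.
    apply (ex_derive_continuous ln). auto_derive; auto.
  - apply (Ccontinuous_scal 2 (fun x => atan (Im x / (Cmod x + Re x)))).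
    apply (Ccontinuous_comp_R atan (fun x => Im x / (Cmod x + Re x))).
    + apply Ccontinuous_mult. apply Ccontinuous_Im.
      apply (Ccontinuous_comp_R Rinv (fun x => Cmod x + Re x)).
      * apply Ccontinuous_plus. apply Ccontinuous_Cmod. apply Ccontinuous_Re.
      * apply (ex_derive_continuous Rinv). auto_derive; auto. lra.
    + apply (ex_derive_continuous atan). auto_derive; auto.
Qed.

(** Inverse-function argument: the increment k of the logarithm satisfies exp k = 1 + h / z, and
    continuity makes k small, so |h / z - k| <= e |k|. With e <= 1/2 this first gives |k| <= 2 |h /
    z|, and then the required error. *)
Lemma Cder_slit_log (z : C) : 0 < Cmod z + Re z -> Cder slit_log z (/ z)%C.
Proof.
  intros H. assert (Hz := slit_neq_0 z H). assert (Hm := proj1 (Cmod_gt_0 z) Hz).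
  apply is_C_derive_eps. intros eps Heps.
  pose (e := Rmin (1 / 2) (eps * Cmod z / 2)).
  assert (He : 0 < e) by (unfold e; apply Rmin_pos; nra).
  assert (He1 : e <= 1 / 2) by apply Rmin_l.
  assert (He2 : e <= eps * Cmod z / 2) by apply Rmin_r.
  destruct (Cexp_near_0 e He) as [d [Hd Hb]].
  destruct (slit_log_continuous z H) as [C1 C2].
  destruct (Ccontinuous_eps _ _ C1 (d / 2) ltac:(lra)) as [d1 [Hd1 B1]].
  destruct (Ccontinuous_eps _ _ C2 (d / 2) ltac:(lra)) as [d2 [Hd2 B2]].
  assert (C3 : Ccontinuous (fun x => Cmod x + Re x) z)
    by (apply Ccontinuous_plus; [apply Ccontinuous_Cmod | apply Ccontinuous_Re]).
  destruct (Ccontinuous_eps _ _ C3 _ H) as [d3 [Hd3 B3]].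
  exists (Rmin d1 (Rmin d2 d3)). split. { repeat apply Rmin_pos; auto. }
  intros h Hh.
  assert (t1 := Rmin_l d1 (Rmin d2 d3)). assert (t2 := Rmin_r d1 (Rmin d2 d3)).
  assert (t3 := Rmin_l d2 d3). assert (t4 := Rmin_r d2 d3).
  specialize (B1 h ltac:(lra)). specialize (B2 h ltac:(lra)). specialize (B3 h ltac:(lra)).
  assert (Hs : 0 < Cmod (z + h) + Re (z + h)%C) by (apply Rabs_def2 in B3; lra).
  pose (k := (slit_log (z + h) - slit_log z)%C).
  assert (Hk : Cmod k < d).
  { eapply Rle_lt_trans; [apply Cmod_le_Rabs|].
    change (Re k) with (Re (slit_log (z + h)%C) - Re (slit_log z)).
    change (Im k) with (Im (slit_log (z + h)%C) - Im (slit_log z)). lra. }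
  specialize (Hb k Hk).
  assert (Ek : Cexp k = (/ z * (z + h))%C).
  { assert (E := Cexp_plus (slit_log z) k).
    replace (slit_log z + k)%C with (slit_log (z + h)) in E by (unfold k; ring).
    rewrite !Cexp_slit_log in E by auto. rewrite E. field; auto. }
  replace (Cexp k - RtoC 1 - k)%C with (/ z * h - k)%C in Hb by (rewrite Ek; field; auto).
  fold k.
  assert (P := Cmod_ge_0 k).
  assert (K1 : Cmod k <= 2 * (Cmod h / Cmod z)).
  { assert (T := Cmod_triangle (k - / z * h) (/ z * h)).
    replace (k - / z * h + / z * h)%C with k in T by ring.
    rewrite <- Cmod_opp in Hb. replace (- (/ z * h - k))%C with (k - / z * h)%C in Hb by ring.
    rewrite (Cmod_mult (/ z) h), Cmod_inv in T by auto. unfold Rdiv.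
    rewrite (Rmult_comm (Cmod h)). nra. }
  rewrite <- Cmod_opp in Hb. replace (- (/ z * h - k))%C with (k - / z * h)%C in Hb by ring.
  assert (P2 := Cmod_ge_0 h).
  apply (Rle_trans _ _ _ Hb).
  apply Rle_trans with (eps * Cmod z / 2 * (2 * (Cmod h / Cmod z))).
  - apply Rmult_le_compat; lra.
  - right. field. lra.
Qed.

(** The bridge from the arccosine form of the principal argument to [slit_log]: the final identity
    takes [Clog] only at a point already written as an exponential. *)
Lemma Clog_Cexp (q : C) : Rabs (Im q) < PI -> Clog (Cexp q) = q.
Proof.
  intros Hq. apply Rabs_def2 in Hq. unfold Clog, Carg. rewrite Cmod_Cexp, ln_exp.
  assert (He := exp_pos (Re q)).
  assert (Ea : Re (Cexp q) / exp (Re q) = cos (Im q)) by (unfold Cexp; simpl; field; lra).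
  rewrite Ea. destruct q as [x y]. simpl Im in *. simpl Re in *. f_equal.
  destruct (Rlt_dec _ 0) as [Hn|Hn]; unfold Cexp in Hn; simpl in Hn.
  - assert (sin y < 0) by nra.
    assert (y < 0).
    { apply Rnot_le_lt. intros T. assert (0 <= sin y) by (apply sin_ge_0; lra). lra. }
    rewrite <- cos_neg, acos_cos; lra.
  - assert (0 <= sin y) by nra.
    assert (0 <= y).
    { apply Rnot_lt_le. intros T. assert (sin y < 0) by (apply sin_lt_0_var; lra). lra. }
    rewrite acos_cos; lra.
Qed.

(** * Complex power series *)

Notation Cseries := (is_series (K := C_AbsRing) (V := C_NormedModule)).

Lemma Cseries_Re_Im (u : nat -> C) (l : C) :
  Cseries u l <->
  is_series (fun k => Re (u k)) (Re l) /\ is_series (fun k => Im (u k)) (Im l).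
Proof.
  assert (SR : forall n, Re (sum_n u n) = sum_n (fun k => Re (u k)) n).
  { induction n as [|n IH]; [now rewrite !sum_O|]. rewrite !sum_Sn, <- IH. reflexivity. }
  assert (SI : forall n, Im (sum_n u n) = sum_n (fun k => Im (u k)) n).
  { induction n as [|n IH]; [now rewrite !sum_O|]. rewrite !sum_Sn, <- IH. reflexivity. }
  split.
  - intros H. split.
    + apply (filterlim_ext (fun n => Re (sum_n u n))); [exact SR|].
      exact (filterlim_comp _ _ _ _ _ _ _ _ H (Ccontinuous_Re l)).
    + apply (filterlim_ext (fun n => Im (sum_n u n))); [exact SI|].
      exact (filterlim_comp _ _ _ _ _ _ _ _ H (Ccontinuous_Im l)).
  - intros [HR HI] P [e He].
    destruct (HR (fun x => ball (Re l) e x)) as [N1 H1]; [exists e; auto|].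
    destruct (HI (fun x => ball (Im l) e x)) as [N2 H2]; [exists e; auto|].
    exists (max N1 N2). intros n Hn. apply He. split.
    + change (ball (Re l) e (Re (sum_n u n))). rewrite SR. apply H1. lia.
    + change (ball (Im l) e (Im (sum_n u n))). rewrite SI. apply H2. lia.
Qed.

Lemma Rseries_dominated (u b : nat -> R) :
  (forall k, Rabs (u k) <= b k) -> ex_series b ->
  is_series u (Series u) /\ Rabs (Series u) <= Series b.
Proof.
  intros H Hb.
  assert (Ha : ex_series (fun k => Rabs (u k))).
  { apply (ex_series_le (K := R_AbsRing) (V := R_CompleteNormedModule) _ b); auto.
    intros k. change (Rabs (Rabs (u k)) <= b k). rewrite Rabs_Rabsolu. auto. }
  split.
  - apply Series_correct, ex_series_Rabs, Ha.
  - eapply Rle_trans; [apply Series_Rabs, Ha|]. apply Series_le; auto.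
    intros k. split; [apply Rabs_pos | auto].
Qed.

(** A total function, so that the derivative of a power series can be named before its convergence
    is known; the value is meaningful only for a convergent series. *)
Definition CSeries (u : nat -> C) : C :=
  (Series (fun k => Re (u k)), Series (fun k => Im (u k))).

Lemma Cseries_unique (u : nat -> C) (l : C) : Cseries u l -> CSeries u = l.
Proof.
  rewrite Cseries_Re_Im. intros [H1 H2]. unfold CSeries.
  rewrite (is_series_unique _ _ H1), (is_series_unique _ _ H2). destruct l; reflexivity.
Qed.

(** The factor 2 is the price of estimating the two components separately. *)
Lemma Cseries_dominated (u : nat -> C) (b : nat -> R) :
  (forall k, Cmod (u k) <= b k) -> ex_series b ->
  Cseries u (CSeries u) /\ Cmod (CSeries u) <= 2 * Series b.
Proof.
  intros H Hb.
  destruct (Rseries_dominated (fun k => Re (u k)) b) as [R1 R2]; auto.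
  { intros k. eapply Rle_trans; [apply re_le_Cmod | auto]. }
  destruct (Rseries_dominated (fun k => Im (u k)) b) as [I1 I2]; auto.
  { intros k. eapply Rle_trans; [apply im_le_Cmod | auto]. }
  split.
  - apply Cseries_Re_Im. split; assumption.
  - eapply Rle_trans; [apply Cmod_le_Rabs|]. simpl. lra.
Qed.

Lemma pow_n_Cpow (z : C) (k : nat) : pow_n (K := C_AbsRing) z k = (z ^ k)%C.
Proof. induction k as [|k IH]; [reflexivity|]. simpl. rewrite IH. reflexivity. Qed.

Lemma is_pseries_Cseries (c : nat -> C) (z l : C) :
  is_pseries (K := C_AbsRing) (V := C_NormedModule) c z l <->
  Cseries (fun k => c k * z ^ k)%C l.
Proof.
  split; apply is_series_ext; intros k; rewrite Cmult_comm, <- (pow_n_Cpow z k); reflexivity.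
Qed.

(** Multiplication by k is differentiation followed by a shift. Used twice, it makes the series of
    k^2 |c k| r^k converge. *)
Lemma CV_radius_mult_INR (a : nat -> R) : CV_radius (fun k => INR k * a k) = CV_radius a.
Proof.
  rewrite <- (CV_radius_derive a), <- (CV_radius_incr_1 (PS_derive a)). apply CV_radius_ext.
  intros [|k]; [simpl; apply Rmult_0_l | reflexivity].
Qed.

(** Convergence at the real point s = (1 + r) / 2 bounds the terms there, so the radius is at least
    s, which exceeds r. *)
Lemma pseries_disc_radius (c : nat -> C) (f : C -> C) (r : R) :
  (forall z, in_disc z -> Cseries (fun k => c k * z ^ k)%C (f z)) ->
  0 <= r < 1 -> Rbar_lt (Rabs r) (CV_radius (fun k => Cmod (c k))).
Proof.
  intros H Hr.
  pose (s := (1 + r) / 2).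
  assert (Hs : in_disc (RtoC s)).
  { unfold in_disc. rewrite Cmod_R, Rabs_right; unfold s; lra. }
  specialize (H _ Hs). apply Cseries_Re_Im in H. destruct H as [HR HI].
  assert (LR := ex_series_lim_0 _ (ex_intro _ _ HR)).
  assert (LI := ex_series_lim_0 _ (ex_intro _ _ HI)).
  destruct (filterlim_bounded (K := R_AbsRing) (V := R_NormedModule) _ (ex_intro _ 0 LR)) as [M1 B1].
  destruct (filterlim_bounded (K := R_AbsRing) (V := R_NormedModule) _ (ex_intro _ 0 LI)) as [M2 B2].
  apply Rbar_lt_le_trans with s.
  { simpl. rewrite Rabs_right; unfold s; lra. }
  apply (proj1 (CV_radius_bounded (fun k => Cmod (c k)))).
  exists (M1 + M2). intros k.
  replace (Cmod (c k) * s ^ k) with (Cmod (c k * RtoC s ^ k)%C).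
  2:{ rewrite Cmod_mult, Cmod_pow, Cmod_R, (Rabs_right s); auto. unfold s; lra. }
  rewrite Rabs_right by (apply Rle_ge, Cmod_ge_0).
  eapply Rle_trans; [apply Cmod_le_Rabs|]. apply Rplus_le_compat; [apply B1 | apply B2].
Qed.

(** The remainders satisfy Q(k+1) = (z + h) Q(k) + k z^(k-1) h^2, and k^2 + k <= (k + 1)^2. The
    factor r^2 on the left avoids the exponent k - 2. *)
Lemma Cpow_taylor_remainder (z h : C) (r : R) (k : nat) :
  0 < r -> Cmod z <= r -> Cmod (z + h) <= r ->
  r ^ 2 * Cmod ((z + h) ^ k - z ^ k - INR k * z ^ (k - 1) * h)%C
    <= INR k ^ 2 * r ^ k * Cmod h ^ 2.
Proof.
  intros Hr Hz Hzh. assert (Ph := Cmod_ge_0 h).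
  induction k as [|k IH].
  - simpl. replace (1 - 1 - RtoC 0 * 1 * h)%C with (RtoC 0) by ring. rewrite Cmod_0. lra.
  - assert (Ez : (INR k * z ^ (k - 1) * z = INR k * z ^ k)%C).
    { destruct k; simpl; [ring|]. replace (k - 0)%nat with k by lia. ring. }
    replace (S k - 1)%nat with k by lia.
    set (Q := ((z + h) ^ k - z ^ k - INR k * z ^ (k - 1) * h)%C) in *.
    replace ((z + h) ^ S k - z ^ S k - INR (S k) * z ^ k * h)%C
      with ((z + h) * Q + INR k * z ^ (k - 1) * (h * h))%C.
    2:{ unfold Q. rewrite S_INR, RtoC_plus. simpl Cpow.
        transitivity ((z + h) * ((z + h) ^ k - z ^ k) - (INR k * z ^ (k - 1) * z) * h)%C; [ring|].
        rewrite Ez. ring. }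
    assert (T := Cmod_triangle ((z + h) * Q) (INR k * z ^ (k - 1) * (h * h))).
    rewrite !Cmod_mult, Cmod_pow, Cmod_R, (Rabs_right (INR k)) in T
      by (apply Rle_ge, pos_INR).
    assert (Pk := pos_INR k). assert (PQ := Cmod_ge_0 Q).
    assert (U : INR k * (r ^ 2 * Cmod z ^ (k - 1)) <= INR k * r ^ S k).
    { destruct k as [|k]; [simpl; lra|]. replace (S k - 1)%nat with k by lia.
      apply Rmult_le_compat_l; auto.
      replace (r ^ S (S k)) with (r ^ 2 * r ^ k) by (simpl; ring).
      apply Rmult_le_compat_l; [nra|]. apply pow_incr. split; [apply Cmod_ge_0 | auto]. }
    assert (V : r ^ 2 * (Cmod (z + h) * Cmod Q) <= r * (INR k ^ 2 * r ^ k * Cmod h ^ 2)).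
    { replace (r ^ 2 * (Cmod (z + h) * Cmod Q)) with (Cmod (z + h) * (r ^ 2 * Cmod Q)) by ring.
      apply Rmult_le_compat; auto; [apply Cmod_ge_0 | nra]. }
    assert (W : 0 <= r ^ S k * Cmod h ^ 2).
    { apply Rmult_le_pos; [apply pow_le; lra | nra]. }
    assert (U2 : INR k * (r ^ 2 * Cmod z ^ (k - 1)) * Cmod h ^ 2 <= INR k * r ^ S k * Cmod h ^ 2)
      by (apply Rmult_le_compat_r; nra).
    rewrite S_INR.
    apply Rle_trans with (r ^ 2 * (Cmod (z + h) * Cmod Q)
      + INR k * (r ^ 2 * Cmod z ^ (k - 1)) * Cmod h ^ 2); [|simpl pow in *; nra].
    assert (R2 : 0 <= r ^ 2) by nra. nra.
Qed.

Definition CPS_derive (c : nat -> C) (k : nat) : C := (INR (S k) * c (S k))%C.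

(** For a radius r between |z| and 1, the Taylor remainders of the single powers add up to at most a
    constant times |h|^2, the constant coming from the sum of k^2 |c k| r^k. *)
Lemma Cpseries_derive (c : nat -> C) (f : C -> C) :
  (forall z, in_disc z -> Cseries (fun k => c k * z ^ k)%C (f z)) ->
  let f1 z := CSeries (fun k => CPS_derive c k * z ^ k)%C in
  forall z, in_disc z ->
    Cseries (fun k => CPS_derive c k * z ^ k)%C (f1 z) /\ Cder f z (f1 z).
Proof.
  intros H f1 z Hz. unfold in_disc in Hz. assert (Pz := Cmod_ge_0 z).
  assert (S1 : Cseries (fun k => CPS_derive c k * z ^ k)%C (f1 z)).
  { assert (Rz := pseries_disc_radius c f (Cmod z) H (conj Pz Hz)).
    rewrite <- CV_radius_derive in Rz. apply CV_disk_inside in Rz.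
    apply (Cseries_dominated _ _ (fun k => Rle_refl _)).
    revert Rz. apply ex_series_ext.
    intros k. unfold PS_derive, CPS_derive.
    rewrite !Cmod_mult, Cmod_pow, Cmod_R.
    rewrite Rabs_right, (Rabs_right (INR (S k))); auto.
    - apply Rle_ge, pos_INR.
    - apply Rle_ge, Rmult_le_pos; [apply Rmult_le_pos; [apply pos_INR | apply Cmod_ge_0]|].
      apply pow_le; auto. }
  split; auto.
  pose (r := (1 + Cmod z) / 2).
  assert (Hr : 0 < r < 1) by (unfold r; lra).
  assert (Rr := pseries_disc_radius c f r H ltac:(lra)).
  rewrite <- CV_radius_mult_INR, <- CV_radius_mult_INR in Rr. apply CV_disk_inside in Rr.
  pose (b := fun k => INR k ^ 2 * Cmod (c k) * r ^ k).
  assert (Eb : ex_series b).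
  { revert Rr. apply ex_series_ext. intros k. unfold b.
    rewrite Rabs_right; [match goal with |- ?x = ?y => change (@eq R x y) end; ring|].
    apply Rle_ge. assert (P1 := pos_INR k). assert (P2 := Cmod_ge_0 (c k)).
    apply Rmult_le_pos; [|apply pow_le; lra]. apply Rmult_le_pos; auto. apply Rmult_le_pos; auto. }
  assert (Pb : 0 <= Series b).
  { assert (T := Rseries_dominated b b). eapply Rle_trans; [apply Rabs_pos|].
    apply T; auto. intros k. rewrite Rabs_right. lra.
    apply Rle_ge. unfold b. apply Rmult_le_pos; [|apply pow_le; lra].
    apply Rmult_le_pos; [apply pow2_ge_0 | apply Cmod_ge_0]. }
  pose (M := 2 * (Series b / r ^ 2)).
  assert (Hr2 : 0 < r ^ 2) by nra.
  assert (PM : 0 <= M).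
  { unfold M. apply Rmult_le_pos; [lra|]. apply Rmult_le_pos; auto.
    apply Rlt_le, Rinv_0_lt_compat; auto. }
  apply is_C_derive_eps. intros eps Heps.
  (* The first bound keeps z + h in the disc of radius r; the 1 in the second covers M = 0. *)
  exists (Rmin (r - Cmod z) (eps / (M + 1))). split.
  { apply Rmin_pos; [unfold r; lra | apply Rdiv_lt_0_compat; lra]. }
  intros h Hh. assert (Ph := Cmod_ge_0 h).
  assert (h1 : Cmod h < r - Cmod z) by (eapply Rlt_le_trans; [exact Hh | apply Rmin_l]).
  assert (h2 : Cmod h < eps / (M + 1)) by (eapply Rlt_le_trans; [exact Hh | apply Rmin_r]).
  assert (Hzh : Cmod (z + h) <= r) by (eapply Rle_trans; [apply Cmod_triangle | lra]).
  assert (S2 := H (z + h)%C ltac:(unfold in_disc; lra)). assert (S3 := H z Hz).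
  assert (S4 : Cseries (fun k => c k * (INR k * z ^ (k - 1)) * h)%C (f1 z * h)%C).
  (* The term of index 0 vanishes through its factor [INR 0], which makes the truncated exponent 0 -
     1 harmless; the tail is the derived series times h. *)
  { apply is_series_decr_1.
    replace (plus _ _) with (f1 z * h)%C.
    2:{ change (f1 z * h = f1 z * h + - (c 0%nat * (INR 0 * z ^ (0 - 1)) * h))%C. simpl. ring. }
    rewrite (Cmult_comm (f1 z) h).
    apply (is_series_scal_l h) in S1. revert S1. apply is_series_ext. intros k.
    change (h * (CPS_derive c k * z ^ k) = c (S k) * (INR (S k) * z ^ (S k - 1)) * h)%C.
    replace (S k - 1)%nat with k by lia. unfold CPS_derive. ring. }
  assert (S5 := is_series_minus _ _ _ _ (is_series_minus _ _ _ _ S2 S3) S4).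
  apply Cseries_unique in S5.
  change (plus (plus (f (z + h)%C) (opp (f z))) (opp (f1 z * h)%C))
    with (f (z + h) - f z - f1 z * h)%C in S5.
  rewrite <- S5.
  eapply Rle_trans; [apply (Cseries_dominated _ (fun k => Cmod h ^ 2 / r ^ 2 * b k))|].
  - intros k.
    change (Cmod (c k * (z + h) ^ k - c k * z ^ k - c k * (INR k * z ^ (k - 1)) * h)%C
      <= Cmod h ^ 2 / r ^ 2 * b k).
    replace (c k * (z + h) ^ k - c k * z ^ k - c k * (INR k * z ^ (k - 1)) * h)%C
      with (c k * ((z + h) ^ k - z ^ k - INR k * z ^ (k - 1) * h))%C by ring.
    rewrite Cmod_mult.
    assert (T := Cpow_taylor_remainder z h r k ltac:(lra) ltac:(unfold r; lra) Hzh).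
    unfold b.
    replace (Cmod h ^ 2 / r ^ 2 * (INR k ^ 2 * Cmod (c k) * r ^ k))
      with (Cmod (c k) * ((INR k ^ 2 * r ^ k * Cmod h ^ 2) / r ^ 2)) by (field; lra).
    apply Rmult_le_compat_l; [apply Cmod_ge_0|].
    apply Rmult_le_reg_l with (r ^ 2); auto.
    replace (r ^ 2 * (INR k ^ 2 * r ^ k * Cmod h ^ 2 / r ^ 2)) with (INR k ^ 2 * r ^ k * Cmod h ^ 2)
      by (field; lra). exact T.
  - apply (ex_series_scal_l (Cmod h ^ 2 / r ^ 2) b Eb).
  - rewrite Series_scal_l.
    replace (2 * (Cmod h ^ 2 / r ^ 2 * Series b)) with (M * Cmod h * Cmod h)
      by (unfold M; field; lra).
    apply Rmult_le_compat_r; auto.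
    assert (eps / (M + 1) * (M + 1) = eps) by (field; lra). nra.
Qed.

(** For k >= n and |z| <= 1/2, |z|^k <= |z|^n 2^n (1/2)^k, so |z|^n comes out of the tail and the
    series at 1/2 remains. *)
Lemma Cpseries_order_bound (c : nat -> C) (f : C -> C) (n : nat) :
  (forall z, in_disc z -> Cseries (fun k => c k * z ^ k)%C (f z)) ->
  (forall k, (0 < k < n)%nat -> c k = RtoC 0) ->
  exists M, 0 <= M /\ forall z, Cmod z <= 1 / 2 -> Cmod (f z - c 0%nat) <= M * Cmod z ^ n.
Proof.
  intros H Hc.
  assert (Rr := pseries_disc_radius c f (1 / 2) H ltac:(lra)).
  apply CV_disk_inside, ex_series_incr_1 in Rr.
  pose (b := fun k => Cmod (c (S k)) * (1 / 2) ^ S k).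
  assert (Nb : forall k, 0 <= b k).
  { intros k. apply Rmult_le_pos; [apply Cmod_ge_0 | apply pow_le; lra]. }
  assert (Eb : ex_series b).
  { revert Rr. apply ex_series_ext. intros k. apply Rabs_right, Rle_ge, Nb. }
  assert (Pb : 0 <= Series b).
  { eapply Rle_trans; [apply Rabs_pos|]. apply (Rseries_dominated b b); auto.
    intros k. rewrite Rabs_right. lra. apply Rle_ge, Nb. }
  exists (2 * 2 ^ n * Series b). split.
  { repeat apply Rmult_le_pos; auto; try lra. apply pow_le; lra. }
  intros z Hz. assert (Pz := Cmod_ge_0 z).
  assert (S1 := H z ltac:(unfold in_disc; lra)).
  assert (S2 : Cseries (fun k => c (S k) * z ^ S k)%C (f z - c 0%nat)%C).
  { apply (is_series_incr_1 (fun k => c k * z ^ k)%C).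
    replace (plus _ _) with (f z); auto.
    change (f z = f z - c 0%nat + c 0%nat * 1)%C. ring. }
  rewrite <- (Cseries_unique _ _ S2).
  eapply Rle_trans; [apply (Cseries_dominated _ (fun k => 2 ^ n * Cmod z ^ n * b k))|].
  - intros k. rewrite Cmod_mult, Cmod_pow. unfold b.
    destruct (Compare_dec.le_lt_dec n (S k)) as [Hk|Hk].
    + replace (2 ^ n * Cmod z ^ n * (Cmod (c (S k)) * (1 / 2) ^ S k))
        with (Cmod (c (S k)) * (Cmod z ^ n * (2 ^ n * (1 / 2) ^ S k))) by ring.
      apply Rmult_le_compat_l; [apply Cmod_ge_0|].
      replace (S k) with (n + (S k - n))%nat by lia. rewrite !pow_add.
      apply Rmult_le_compat_l; [apply pow_le; auto|].
      rewrite <- Rmult_assoc, <- Rpow_mult_distr.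
      replace (2 * (1 / 2)) with 1 by field. rewrite pow1, Rmult_1_l.
      apply pow_incr; lra.
    + rewrite Hc by lia. rewrite Cmod_0. lra.
  - apply (ex_series_scal_l (2 ^ n * Cmod z ^ n) b Eb).
  - rewrite Series_scal_l. right. ring.
Qed.

(** * First exit from a sector and the Schwarz lemma *)

(** The points (1 - s) z lie in the open disc and approach z. *)
Lemma Ccontinuous_ge0_of_disc (g : C -> R) (z : C) (r : R) :
  Ccontinuous g z -> 0 < r -> Cmod z <= r ->
  (forall y, Cmod y < r -> 0 <= g y) -> 0 <= g z.
Proof.
  intros Hg Hr Hz H. apply Rnot_lt_le. intros Hlt.
  destruct (Ccontinuous_eps g z Hg (- g z) ltac:(lra)) as [d [Hd Hb]].
  pose (s := Rmin (1 / 2) (d / (2 * r))).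
  assert (Hq : 0 < d / (2 * r)) by (apply Rdiv_lt_0_compat; lra).
  assert (Hs : 0 < s) by (apply Rmin_pos; lra).
  assert (s1 : s <= 1 / 2) by apply Rmin_l. assert (s2 : s <= d / (2 * r)) by apply Rmin_r.
  assert (Hsr : s * r <= d / 2).
  { replace (d / 2) with (d / (2 * r) * r) by (field; lra). apply Rmult_le_compat_r; lra. }
  assert (Pz := Cmod_ge_0 z).
  assert (Em : Cmod (- RtoC s * z) = s * Cmod z).
  { rewrite Cmod_mult, Cmod_opp, Cmod_R, Rabs_right; lra. }
  assert (Eh : Cmod (z + - RtoC s * z) = (1 - s) * Cmod z).
  { replace (z + - RtoC s * z)%C with (RtoC (1 - s) * z)%C by (rewrite RtoC_minus; ring).
    rewrite Cmod_mult, Cmod_R, Rabs_right; lra. }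
  specialize (Hb (- RtoC s * z)%C ltac:(rewrite Em; nra)).
  specialize (H (z + - RtoC s * z)%C ltac:(rewrite Eh; nra)).
  apply Rabs_def2 in Hb. lra.
Qed.

(** The first conjunct excludes the slit: at 0 and at negative reals the formula of [slit_log] would
    yield the argument 2 atan 0 = 0. *)
Definition in_sector (a : R) (u : C) : Prop :=
  0 < Cmod u + Re u /\ Rabs (Im (slit_log u)) < a.

Lemma in_sector_open (a : R) (u : C) : in_sector a u ->
  exists d, 0 < d /\ forall h : C, Cmod h < d -> in_sector a (u + h).
Proof.
  intros [H1 H2].
  assert (C3 : Ccontinuous (fun x => Cmod x + Re x) u)
    by (apply Ccontinuous_plus; [apply Ccontinuous_Cmod | apply Ccontinuous_Re]).
  destruct (Ccontinuous_eps _ _ C3 _ H1) as [d1 [Hd1 B1]].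
  destruct (slit_log_continuous u H1) as [_ C2].
  destruct (Ccontinuous_eps _ _ C2 (a - Rabs (Im (slit_log u))) ltac:(lra)) as [d2 [Hd2 B2]].
  exists (Rmin d1 d2). split; [apply Rmin_pos; auto|].
  intros h Hh. assert (t1 := Rmin_l d1 d2). assert (t2 := Rmin_r d1 d2).
  specialize (B1 h ltac:(lra)). specialize (B2 h ltac:(lra)). split.
  - apply Rabs_def2 in B1. lra.
  - assert (T := Rabs_triang (Im (slit_log (u + h)) - Im (slit_log u)) (Im (slit_log u))).
    replace (Im (slit_log (u + h)) - Im (slit_log u) + Im (slit_log u))
      with (Im (slit_log (u + h))) in T by ring.
    lra.
Qed.

Lemma in_sector_Re_pos (a : R) (u : C) : a <= PI / 2 -> in_sector a u -> 0 < Re u.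
Proof.
  intros Ha [H1 H2]. rewrite <- (Cexp_slit_log u H1).
  change (0 < exp (Re (slit_log u)) * cos (Im (slit_log u))).
  apply Rmult_lt_0_compat; [apply exp_pos|]. apply Rabs_def2 in H2. apply cos_gt_0; lra.
Qed.

Lemma slit_log_1 : slit_log (RtoC 1) = RtoC 0.
Proof.
  unfold slit_log. rewrite Cmod_1, ln_1. simpl.
  replace (0 / (1 + 1)) with 0 by field. rewrite atan_0, Rmult_0_r. reflexivity.
Qed.

(** The sector is open and p continuous, so the points outside it with modulus at most |zb| form a
    compact set, on which [Cmod] has a minimum. *)
Lemma first_exit (p p1 : C -> C) (a : R) :
  (forall z, in_disc z -> Cder p z (p1 z)) ->
  (exists z, in_disc z /\ ~ in_sector a (p z)) ->
  exists z0, in_disc z0 /\ ~ in_sector a (p z0) /\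
    forall z, Cmod z < Cmod z0 -> in_sector a (p z).
Proof.
  intros Dp [zb [Hzb Nzb]].
  destruct (bounded_closed_max (fun z => Cmod z <= Cmod zb /\ ~ in_sector a (p z))
    (fun z => - Cmod z) (Cmod zb) 0) as [z0 [[H1 H2] H3]].
  - exists zb. split; [lra | auto].
  - intros z [Hz _]; auto.
  - intros z _. assert (T := Cmod_ge_0 z). lra.
  - intros z Hz. destruct (Rle_lt_dec (Cmod z) (Cmod zb)) as [Hle|Hlt].
    + assert (Hg : in_sector a (p z)) by (apply NNPP; intros Hn; apply Hz; auto).
      destruct (in_sector_open a _ Hg) as [e [He Hb]].
      destruct (Cder_continuity p z (p1 z) (Dp z ltac:(unfold in_disc in *; lra)) e He)
        as [d [Hd Hb']].
      exists d. split; auto. intros h Hh [_ Hn]. apply Hn.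
      specialize (Hb _ (Hb' h Hh)).
      replace (p z + (p (z + h) - p z))%C with (p (z + h)%C) in Hb by ring. exact Hb.
    + exists (Cmod z - Cmod zb). split; [lra|]. intros h Hh [Hn _].
      assert (T := Cmod_triangle (z + h) (- h)). rewrite Cmod_opp in T.
      replace (z + h + - h)%C with z in T by ring. lra.
  - intros z _ eps Heps. exists eps. split; auto. intros h Hh _.
    assert (T := Cmod_triangle (z + h) (- h)). rewrite Cmod_opp in T.
    replace (z + h + - h)%C with z in T by ring. lra.
  - exists z0. split; [unfold in_disc in *; lra|]. split; auto.
    intros z Hz. apply NNPP. intros Hn.
    assert (Hle : Cmod z <= Cmod zb) by lra. specialize (H3 z (conj Hle Hn)). cbv beta in H3. lra.
Qed.

(** A sector of half-angle at most PI / 2 lies in Re > 0, so Re p >= 0 in the limit. As p is not 0,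
    its value is off the slit, where the argument is continuous and keeps its bound. *)
Lemma closure_of_sector (p p1 : C -> C) (a : R) (z0 z : C) :
  a <= PI / 2 -> (forall z, in_disc z -> Cder p z (p1 z)) -> p z <> RtoC 0 ->
  in_disc z0 -> z0 <> RtoC 0 -> (forall y, Cmod y < Cmod z0 -> in_sector a (p y)) ->
  Cmod z <= Cmod z0 ->
  0 < Cmod (p z) + Re (p z) /\ Rabs (Im (slit_log (p z))) <= a.
Proof.
  intros Ha Dp Hp Hz0 Nz0 H Hz. apply Cmod_gt_0 in Nz0. unfold in_disc in Hz0.
  assert (Dz := Dp z ltac:(unfold in_disc; lra)).
  assert (R0 : 0 <= Re (p z)).
  { apply (Ccontinuous_ge0_of_disc (fun z => Re (p z)) z (Cmod z0)); auto.
    - apply (Ccontinuous_comp p Re z (p1 z)); auto. apply Ccontinuous_Re.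
    - intros y Hy. apply Rlt_le, (in_sector_Re_pos a); auto. }
  assert (S0 : 0 < Cmod (p z) + Re (p z)) by (apply Cmod_gt_0 in Hp; lra).
  split; auto.
  destruct (slit_log_continuous (p z) S0) as [_ Cl].
  assert (Cl' := Ccontinuous_comp p _ z (p1 z) Dz Cl).
  apply Rabs_le. split.
  - cut (0 <= a + Im (slit_log (p z))); [lra|].
    apply (Ccontinuous_ge0_of_disc (fun z => a + Im (slit_log (p z))) z (Cmod z0)); auto.
    + apply Ccontinuous_plus; auto. apply Ccontinuous_const.
    + intros y Hy. destruct (H y Hy) as [_ T]. apply Rabs_def2 in T. lra.
  - cut (0 <= a + -1 * Im (slit_log (p z))); [lra|].
    apply (Ccontinuous_ge0_of_disc (fun z => a + -1 * Im (slit_log (p z))) z (Cmod z0)); auto.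
    + apply Ccontinuous_plus; [apply Ccontinuous_const|].
      apply (Ccontinuous_scal (-1) (fun x => Im (slit_log (p x)))). exact Cl'.
    + intros y Hy. destruct (H y Hy) as [_ T]. apply Rabs_def2 in T. lra.
Qed.

Lemma exp_INR_mult (n : nat) (x : R) : exp (INR n * x) = exp x ^ n.
Proof.
  induction n as [|n IH]; [simpl; rewrite Rmult_0_l; apply exp_0|].
  rewrite S_INR, Rmult_plus_distr_r, exp_plus, IH, Rmult_1_l. simpl. ring.
Qed.

(* In the coordinate [z = z0 * exp zeta], the function [w (z) / z^n] becomes
   [w (z0 exp zeta) exp (- n zeta)] on the half-plane, with no puncture to remove. *)
Lemma schwarz_order (w w1 : C -> C) (z0 : C) (n : nat) (M : R) :
  (forall z, Cmod z <= Cmod z0 -> Cder w z (w1 z)) ->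
  (forall z, Cmod z <= Cmod z0 -> exists l : C, Cder w1 z l) ->
  (forall z, Cmod z <= Cmod z0 -> Cmod (w z) <= 1) ->
  (forall z, Cmod z <= Cmod z0 -> Cmod (w z) <= M * Cmod z ^ n) ->
  forall x, x <= 0 -> Cmod (w (z0 * Cexp (RtoC x))%C) <= exp x ^ n.
Proof.
  intros D1 D2 B1 BM.
  pose (v := fun x => (z0 * Cexp x)%C).
  pose (e := fun x => Cexp (- INR n * x)%C).
  assert (Dv : forall x, Cder v x (v x)).
  { intros x. apply (Cder_scal z0 Cexp), Cder_Cexp. }
  assert (De : forall x, Cder e x (- INR n * e x)%C).
  { intros x. refine (Cder_eq _ _ _ _ (Cder_comp Cexp (fun x => - INR n * x)%C x _ _
      (Cder_Cexp _) (Cder_scal _ (fun x => x) x _ (Cder_id x))) _). unfold e. ring. }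
  assert (Mv : forall x, Re x <= 0 -> Cmod (v x) <= Cmod z0).
  { intros x Hx. unfold v. rewrite Cmod_mult, Cmod_Cexp.
    assert (exp (Re x) <= 1) by (rewrite <- exp_0; destruct Hx as [Hx| ->]; [apply Rlt_le, exp_increasing, Hx | lra]).
    assert (T := Cmod_ge_0 z0). nra. }
  assert (Me : forall x, Cmod (e x) * exp (Re x) ^ n = 1).
  { intros x. unfold e. rewrite Cmod_Cexp, <- exp_INR_mult, <- exp_plus, <- exp_0.
    f_equal. unfold Re, Cmult, Copp, RtoC; simpl. ring. }
  assert (Ex : forall x, 0 < exp (Re x) ^ n) by (intros; apply pow_lt, exp_pos).
  assert (Mp : forall x, 0 <= Cmod (e x)) by (intros; apply Cmod_ge_0).
  assert (F : forall x, Re x <= 0 -> Cmod (w (v x) * e x)%C <= 1).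
  { apply (half_plane_max_principle (fun x => w (v x) * e x)%C
      (fun x => v x * w1 (v x) * e x + w (v x) * (- INR n * e x))%C (M * Cmod z0 ^ n)).
    - intros x Hx. apply (Cder_mult (fun x => w (v x)) e); [|apply De].
      apply (Cder_comp w v); [apply D1, Mv, Hx | apply Dv].
    - intros x Hx. destruct (D2 (v x) (Mv x ltac:(lra))) as [l Hl].
      eexists. apply (Cder_plus (fun x => v x * w1 (v x) * e x)%C (fun x => w (v x) * (- INR n * e x))%C).
      + apply (Cder_mult (fun x => v x * w1 (v x))%C e); [|apply De].
        apply (Cder_mult v (fun x => w1 (v x))); [apply Dv|].
        apply (Cder_comp w1 v); [exact Hl | apply Dv].
      + apply (Cder_mult (fun x => w (v x)) (fun x => - INR n * e x)%C).
        * apply (Cder_comp w v); [apply D1, Mv; lra | apply Dv].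
        * apply (Cder_scal _ e), De.
    - intros x Hx. rewrite Cmod_mult.
      (* Global boundedness, as Phragmen-Lindeloef demands: the order of vanishing of w cancels the
         growth of exp(- n x) as Re x -> -oo. *)
      apply Rle_trans with (M * Cmod (v x) ^ n * Cmod (e x)).
      + apply Rmult_le_compat_r; auto.
      + right. unfold v. rewrite Cmod_mult, Cmod_Cexp, Rpow_mult_distr.
        rewrite <- (Rmult_1_r (M * Cmod z0 ^ n)), <- (Me x). ring.
    - intros x Hx. rewrite Cmod_mult.
      specialize (Me x). rewrite Hx, exp_0, pow1 in Me. rewrite Rmult_1_r in Me. rewrite Me.
      rewrite Rmult_1_r. apply B1, Mv, Req_le, Hx. }
  intros x Hx. specialize (F (RtoC x) Hx). rewrite Cmod_mult in F.
  specialize (Me (RtoC x)). specialize (Ex (RtoC x)). change (Re (RtoC x)) with x in *.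
  fold (v (RtoC x)).
  replace (Cmod (w (v (RtoC x)))) with (Cmod (w (v (RtoC x))) * Cmod (e (RtoC x)) * exp x ^ n)
    by (rewrite Rmult_assoc, Me; ring).
  rewrite <- (Rmult_1_l (exp x ^ n)) at 2. apply Rmult_le_compat_r; lra.
Qed.

(** * Cayley transform of a power *)

Definition cayley (u : C) : C := ((u - 1) / (u + 1))%C.

Lemma Re_ge0_plus_1_neq_0 (u : C) : 0 <= Re u -> (u + 1)%C <> RtoC 0.
Proof. intros H E. apply (f_equal Re) in E. simpl in E. unfold Re in H. lra. Qed.

Lemma Cmod2_plus_minus_1 (u : C) :
  Cmod (u - 1)%C ^ 2 = Cmod u ^ 2 - 2 * Re u + 1 /\
  Cmod (u + 1)%C ^ 2 = Cmod u ^ 2 + 2 * Re u + 1.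
Proof.
  rewrite !Cmod2_alt. destruct u as [x y].
  unfold Re, Im, Cminus, Cplus, Copp, RtoC; simpl. split; ring.
Qed.

Lemma Cmod_cayley_le (u : C) (r : R) : 0 <= Re u ->
  Cmod (cayley u) <= r <-> Cmod (u - 1)%C <= r * Cmod (u + 1)%C.
Proof.
  intros H. assert (N := Re_ge0_plus_1_neq_0 u H). assert (P := proj1 (Cmod_gt_0 _) N).
  unfold cayley. rewrite Cmod_div by auto. split; intros T.
  - apply (Rmult_le_compat_r (Cmod (u + 1))) in T; [|lra].
    unfold Rdiv in T. rewrite Rmult_assoc, Rinv_l, Rmult_1_r in T; lra.
  - apply Rmult_le_reg_r with (Cmod (u + 1)); auto.
    unfold Rdiv. rewrite Rmult_assoc, Rinv_l, Rmult_1_r; lra.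
Qed.

Lemma Cmod_cayley_le_1 (u : C) : 0 <= Re u -> Cmod (cayley u) <= 1.
Proof.
  intros H. apply Cmod_cayley_le; auto. rewrite Rmult_1_l.
  destruct (Cmod2_plus_minus_1 u).
  assert (P1 := Cmod_ge_0 (u - 1)%C). assert (P2 := Cmod_ge_0 (u + 1)%C). nra.
Qed.

Lemma Cmod_cayley_lt_1 (u : C) : 0 < Re u -> Cmod (cayley u) < 1.
Proof.
  intros H. assert (N := Re_ge0_plus_1_neq_0 u (Rlt_le _ _ H)).
  assert (P := proj1 (Cmod_gt_0 _) N).
  unfold cayley. rewrite Cmod_div by auto.
  apply Rmult_lt_reg_r with (Cmod (u + 1)); auto.
  unfold Rdiv. rewrite Rmult_assoc, Rinv_l, Rmult_1_r; [|lra].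
  destruct (Cmod2_plus_minus_1 u).
  assert (P1 := Cmod_ge_0 (u - 1)%C). nra.
Qed.

Lemma cayley_inv (u : C) : 0 <= Re u ->
  ((1 + cayley u) / (1 - cayley u) = u)%C.
Proof.
  intros H. assert (N := Re_ge0_plus_1_neq_0 u H). unfold cayley.
  assert (E1 : (1 + (u - 1) / (u + 1) = 2 * u / (u + 1))%C) by (field; auto).
  assert (E2 : (1 - (u - 1) / (u + 1) = 2 / (u + 1))%C) by (field; auto).
  rewrite E1, E2. field. auto.
Qed.

(* [|cayley (exp (s + i t))|^2 = (cosh s - cos t) / (cosh s + cos t)], which is smallest
   at [s = 0]. *)
Lemma cayley_Cexp_cos_bound (q : C) (r : R) :
  0 <= r <= 1 -> 0 <= cos (Im q) -> Cmod (cayley (Cexp q)) <= r ->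
  1 - r ^ 2 <= cos (Im q) * (1 + r ^ 2).
Proof.
  intros Hr Hc H.
  assert (X0 := exp_pos (Re q)).
  assert (Hre : 0 <= Re (Cexp q)).
  { change (0 <= exp (Re q) * cos (Im q)). apply Rmult_le_pos; lra. }
  apply Cmod_cayley_le in H; auto.
  destruct (Cmod2_plus_minus_1 (Cexp q)) as [E1 E2]. rewrite Cmod_Cexp in E1, E2.
  change (Re (Cexp q)) with (exp (Re q) * cos (Im q)) in E1, E2.
  set (X := exp (Re q)) in *. set (c := cos (Im q)) in *.
  assert (S : Cmod (Cexp q - 1)%C ^ 2 <= r ^ 2 * Cmod (Cexp q + 1)%C ^ 2).
  { rewrite <- Rpow_mult_distr. apply pow_incr. split; [apply Cmod_ge_0 | auto]. }
  rewrite E1, E2 in S.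
  assert (r2 : 0 <= 1 - r ^ 2) by nra.
  (* This is cosh s >= 1 in the form 2 X <= X^2 + 1; it removes the dependence on the modulus X. *)
  assert (T : 0 <= (1 - r ^ 2) * (X - 1) ^ 2) by (apply Rmult_le_pos; [auto | apply pow2_ge_0]).
  apply Rmult_le_reg_l with X; auto. nra.
Qed.

Definition slit_root (alpha : R) (x : C) : C := Cexp (RtoC (/ alpha) * slit_log x).

(** The derivative of (u - 1) / (u + 1) as 2 u' / (u + 1)^2. It is named because the maximum
    principle asks it to be differentiable in turn. *)
Definition cayley_root_derive (alpha : R) (x : C) : C :=
  (2 * (RtoC (/ alpha) * / x * slit_root alpha x) /
    ((slit_root alpha x + 1) * (slit_root alpha x + 1)))%C.

Lemma Cder_slit_root (alpha : R) (x : C) : 0 < Cmod x + Re x ->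
  Cder (slit_root alpha) x (RtoC (/ alpha) * / x * slit_root alpha x)%C.
Proof.
  intros H. apply (Cder_comp Cexp (fun x => RtoC (/ alpha) * slit_log x)%C).
  - apply Cder_Cexp.
  - apply Cder_scal, Cder_slit_log, H.
Qed.

Lemma Cder_cayley_root (alpha : R) (x : C) :
  0 < Cmod x + Re x -> (slit_root alpha x + 1)%C <> RtoC 0 ->
  Cder (fun x => cayley (slit_root alpha x)) x (cayley_root_derive alpha x).
Proof.
  intros H N. assert (D := Cder_slit_root alpha x H). unfold cayley.
  refine (Cder_eq _ _ _ _ (Cder_div (fun x => slit_root alpha x - 1)%C
    (fun x => slit_root alpha x + 1)%C x _ _ N
    (Cder_minus _ _ _ _ _ D (Cder_const 1 x)) (Cder_plus _ _ _ _ _ D (Cder_const 1 x))) _).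
  unfold cayley_root_derive. field. split; auto. apply slit_neq_0; auto.
Qed.

Lemma ex_Cder_cayley_root_derive (alpha : R) (x : C) :
  0 < Cmod x + Re x -> (slit_root alpha x + 1)%C <> RtoC 0 ->
  exists l : C, Cder (cayley_root_derive alpha) x l.
Proof.
  intros H N. assert (D := Cder_slit_root alpha x H). assert (Nx := slit_neq_0 x H).
  assert (D1 := Cder_plus _ _ _ _ _ D (Cder_const 1 x)).
  eexists. unfold cayley_root_derive.
  apply (Cder_div (fun x => 2 * (RtoC (/ alpha) * / x * slit_root alpha x))%C
    (fun x => (slit_root alpha x + 1) * (slit_root alpha x + 1))%C).
  - apply Cmult_neq_0; auto.
  - apply Cder_scal.
    apply (Cder_mult (fun x => RtoC (/ alpha) * / x)%C (slit_root alpha)); [|exact D].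
    apply Cder_scal, Cder_inv, Nx.
  - apply (Cder_mult _ _ _ _ _ D1 D1).
Qed.

Lemma Im_RtoC_mult (a : R) (z : C) : Im (RtoC a * z)%C = a * Im z.
Proof. unfold Im, Cmult, RtoC; simpl. ring. Qed.

(** Dividing the argument by alpha opens the sector to the right half-plane. *)
Lemma Re_slit_root (alpha : R) (x : C) : 0 < alpha ->
  (Rabs (Im (slit_log x)) <= alpha * PI / 2 -> 0 <= Re (slit_root alpha x)) /\
  (Rabs (Im (slit_log x)) < alpha * PI / 2 -> 0 < Re (slit_root alpha x)).
Proof.
  intros Ha.
  assert (E : Re (slit_root alpha x) =
    exp (Re (RtoC (/ alpha) * slit_log x)%C) * cos (/ alpha * Im (slit_log x))).
  { unfold slit_root. rewrite <- Im_RtoC_mult. reflexivity. }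
  rewrite E. clear E.
  assert (X := exp_pos (Re (RtoC (/ alpha) * slit_log x)%C)).
  assert (Ia : 0 < / alpha) by (apply Rinv_0_lt_compat; auto).
  assert (Ea : / alpha * (alpha * PI / 2) = PI / 2) by (field; lra).
  split; intros H.
  - apply Rmult_le_pos; [lra|]. apply Rabs_le_between in H.
    apply cos_ge_0; nra.
  - apply Rmult_lt_0_compat; [lra|]. apply Rabs_def2 in H.
    apply cos_gt_0; nra.
Qed.

(** * The boundary point *)

Lemma slit_root_1 (alpha : R) : slit_root alpha (RtoC 1) = RtoC 1.
Proof. unfold slit_root. rewrite slit_log_1, Cmult_0_r. apply Cexp_0. Qed.

Lemma cayley_1 : cayley (RtoC 1) = RtoC 0.
Proof. unfold cayley. unfold Cdiv. ring. Qed.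

(** Near 0, differentiability of the Cayley root at p(0) = 1 carries the order of p - 1 over to w;
    for |z| >= q, the bound 1 is at most (|z| / q)^n. The size of M is immaterial, since
    Phragmen-Lindeloef only asks for some bound. *)
Lemma cayley_root_order_bound (p : C -> C) (alpha M0 r : R) (n : nat) (l : C) :
  (0 < n)%nat -> 0 < r -> r <= 1 -> Cder p (RtoC 0) l -> p (RtoC 0) = RtoC 1 ->
  (forall z, Cmod z <= 1 / 2 -> Cmod (p z - 1)%C <= M0 * Cmod z ^ n) ->
  (forall z, Cmod z <= r -> Cmod (cayley (slit_root alpha (p z))) <= 1) ->
  exists M, forall z, Cmod z <= r ->
    Cmod (cayley (slit_root alpha (p z))) <= M * Cmod z ^ n.
Proof.
  intros Hn Hr Hr1 Dp P0 B0 B1.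
  assert (Hs : 0 < Cmod (RtoC 1) + Re (RtoC 1)) by (rewrite Cmod_1; simpl; lra).
  assert (D := Cder_cayley_root alpha (RtoC 1) Hs).
  rewrite slit_root_1 in D. specialize (D (Re_ge0_plus_1_neq_0 1 ltac:(simpl; lra))).
  set (k := cayley_root_derive alpha (RtoC 1)) in *.
  rewrite is_C_derive_eps in D. destruct (D 1 Rlt_0_1) as [d [Hd Hb]].
  destruct (Cder_continuity p _ l Dp d Hd) as [e [He Hc]].
  pose (q := Rmin e (1 / 2)).
  assert (Hq : 0 < q) by (apply Rmin_pos; lra).
  assert (q1 : q <= e) by apply Rmin_l. assert (q2 : q <= 1 / 2) by apply Rmin_r.
  assert (Pk := Cmod_ge_0 k).
  assert (Near : forall z, Cmod z < q ->
    Cmod (cayley (slit_root alpha (p z))) <= (1 + Cmod k) * M0 * Cmod z ^ n).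
  { intros z Hz. specialize (Hc z ltac:(lra)). rewrite P0, Cplus_0_l in Hc.
    specialize (Hb _ Hc). specialize (B0 z ltac:(lra)).
    rewrite slit_root_1, cayley_1 in Hb.
    replace (1 + (p z - 1))%C with (p z) in Hb by ring.
    assert (T := Cmod_triangle (cayley (slit_root alpha (p z)) - 0 - k * (p z - 1))
      (k * (p z - 1))).
    replace (cayley (slit_root alpha (p z)) - 0 - k * (p z - 1) + k * (p z - 1))%C
      with (cayley (slit_root alpha (p z))) in T by ring.
    rewrite (Cmod_mult k) in T. assert (P1 := Cmod_ge_0 (p z - 1)%C). nra. }
  assert (Hqn : 0 < q ^ n) by (apply pow_lt; auto).
  exists (Rmax ((1 + Cmod k) * M0) (/ q ^ n)).
  intros z Hz. assert (Pz := Cmod_ge_0 z).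
  destruct (Rlt_le_dec (Cmod z) q) as [Hlt|Hle].
  - eapply Rle_trans; [apply Near, Hlt|]. apply Rmult_le_compat_r; [apply pow_le; auto|].
    apply Rmax_l.
  - eapply Rle_trans; [apply B1, Hz|].
    apply Rle_trans with (/ q ^ n * q ^ n); [right; field; lra|].
    apply Rmult_le_compat; [apply Rlt_le, Rinv_0_lt_compat; auto | lra | apply Rmax_r |].
    apply pow_incr; lra.
Qed.

(** In this chart d/dx is z d/dz. Real x moves along the radius through z0, imaginary x along the
    circle. *)
Lemma Cder_polar (F : C -> C) (z0 x l : C) :
  Cder F (z0 * Cexp x)%C l -> Cder (fun x => F (z0 * Cexp x)%C) x (z0 * Cexp x * l)%C.
Proof.
  intros H. apply (Cder_comp F (fun x => z0 * Cexp x)%C); auto.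
  apply Cder_scal, Cder_Cexp.
Qed.

Lemma is_derive_line_0 (F : C -> C) (d l : C) (t : R) :
  Cder F (RtoC t * d)%C l ->
  is_derive (fun s : R => Re (F (RtoC s * d)%C)) t (Re (l * d)%C) /\
  is_derive (fun s : R => Im (F (RtoC s * d)%C)) t (Im (l * d)%C).
Proof.
  intros H. rewrite <- (Cplus_0_l (RtoC t * d)) in H. apply is_derive_line in H.
  destruct H as [H1 H2].
  split; [revert H1 | revert H2]; apply is_derive_ext; intros s; rewrite Cplus_0_l; reflexivity.
Qed.

Lemma radial_derivative_bound (p p1 p2 : C -> C) (alpha M0 s : R) (n : nat) (z0 : C) :
  (0 < n)%nat -> 0 < alpha -> in_disc z0 -> z0 <> RtoC 0 ->
  (forall z, in_disc z -> Cder p z (p1 z)) ->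
  (forall z, in_disc z -> Cder p1 z (p2 z)) ->
  p (RtoC 0) = RtoC 1 ->
  (forall z, Cmod z <= 1 / 2 -> Cmod (p z - 1)%C <= M0 * Cmod z ^ n) ->
  (forall z, Cmod z <= Cmod z0 ->
    0 < Cmod (p z) + Re (p z) /\ Rabs (Im (slit_log (p z))) <= alpha * PI / 2) ->
  s * s = 1 -> Im (slit_log (p z0)) = s * (alpha * PI / 2) ->
  INR n * alpha <= s * Im (z0 * p1 z0 / p z0)%C.
Proof.
  intros Hn Ha Hz0 Nz0 D1 D2 P0 B0 Hcl Hs Him.
  unfold in_disc in Hz0. apply Cmod_gt_0 in Nz0.
  assert (Ia : 0 < / alpha) by (apply Rinv_0_lt_compat; auto).
  assert (Hre : forall z, Cmod z <= Cmod z0 -> 0 <= Re (slit_root alpha (p z))).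
  { intros z Hz. apply Re_slit_root; auto. apply Hcl; auto. }
  assert (Hle : forall z, Cmod z <= Cmod z0 -> Cmod (cayley (slit_root alpha (p z))) <= 1).
  { intros z Hz. apply Cmod_cayley_le_1; auto. }
  destruct (cayley_root_order_bound p alpha M0 (Cmod z0) n (p1 (RtoC 0))) as [M HM]; auto; try lra.
  { apply D1. unfold in_disc. rewrite Cmod_0. lra. }
  assert (Sch := schwarz_order (fun z => cayley (slit_root alpha (p z)))
    (fun z => p1 z * cayley_root_derive alpha (p z))%C z0 n M).
  cbv beta in Sch.
  assert (Sch' : forall x, x <= 0 ->
    Cmod (cayley (slit_root alpha (p (z0 * Cexp (RtoC x))%C))) <= exp x ^ n).
  { apply Sch; auto.
    - intros z Hz. apply (Cder_comp (fun x => cayley (slit_root alpha x)) p).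
      + apply Cder_cayley_root; [apply Hcl, Hz | apply Re_ge0_plus_1_neq_0, Hre, Hz].
      + apply D1. unfold in_disc; lra.
    - intros z Hz. assert (Iz : in_disc z) by (unfold in_disc; lra).
      destruct (ex_Cder_cayley_root_derive alpha (p z)) as [k Hk];
        [apply Hcl, Hz | apply Re_ge0_plus_1_neq_0, Hre, Hz |].
      eexists. apply (Cder_mult p1 (fun z => cayley_root_derive alpha (p z))); [apply D2, Iz|].
      apply (Cder_comp (cayley_root_derive alpha) p); [exact Hk | apply D1, Iz]. }
  (* The factor 1 is the radial direction [d] of [is_derive_line_0]. *)
  pose (theta := fun x : R => / alpha * Im (slit_log (p (z0 * Cexp (RtoC x * 1))%C))).
  assert (Dth : is_derive theta 0 (/ alpha * Im (z0 * p1 z0 / p z0)%C)).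
  { assert (E0 : (z0 * Cexp (RtoC 0 * 1))%C = z0).
    { rewrite Cmult_0_l, Cexp_0. ring. }
    assert (H0 := proj1 (Hcl z0 (Rle_refl _))).
    assert (D : Cder (fun x => slit_log (p x)) (z0 * Cexp (RtoC 0 * 1))%C (p1 z0 * / p z0)%C).
    { rewrite E0. apply (Cder_comp slit_log p); [apply Cder_slit_log, H0 | apply D1; auto]. }
    apply Cder_polar in D. apply is_derive_line_0, proj2 in D.
    apply (is_derive_scal _ _ (/ alpha)) in D. rewrite E0 in D.
    replace (z0 * (p1 z0 * / p z0) * 1)%C with (z0 * p1 z0 / p z0)%C in D
      by (unfold Cdiv; ring).
    exact D. }
  assert (th0 : theta 0 = s * (PI / 2)).
  { unfold theta. rewrite Cmult_0_l, Cexp_0, Cmult_1_r, Him. field. lra. }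
  assert (Hs' : s = 1 \/ s = -1).
  { destruct (Rle_lt_dec 0 s); [left | right]; nra. }
  assert (c0 : cos (theta 0) = 0).
  { rewrite th0. destruct Hs' as [-> | ->].
    - rewrite Rmult_1_l. apply cos_PI2.
    - replace (-1 * (PI / 2)) with (- (PI / 2)) by ring. rewrite cos_neg. apply cos_PI2. }
  assert (s0 : sin (theta 0) = s).
  { rewrite th0. destruct Hs' as [-> | ->].
    - rewrite Rmult_1_l. apply sin_PI2.
    - replace (-1 * (PI / 2)) with (- (PI / 2)) by ring. rewrite sin_neg, sin_PI2. ring. }
  (* For x <= 0, g <= 0 says cos theta >= - tanh (n x). At 0 the cosine vanishes and the sine is s,
     so g 0 = 0 and g' 0 = - 2 n + 2 s theta' 0. *)
  pose (g := fun x => 1 - exp (INR n * x) ^ 2 - cos (theta x) * (1 + exp (INR n * x) ^ 2)).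
  assert (G : 0 <= - (2 * INR n) + 2 * s * (/ alpha * Im (z0 * p1 z0 / p z0)%C)).
  { apply (left_max_derive_ge0 g _ 1); [lra | |].
    - unfold g. auto_derive.
      + repeat split; eexists; exact Dth.
      + replace (Derive (fun x => theta x) 0) with (/ alpha * Im (z0 * p1 z0 / p z0)%C)
          by (symmetry; apply (is_derive_unique (fun x : R => theta x)), Dth).
        rewrite s0, c0, Rmult_0_r, exp_0. ring.
    - intros t Ht.
      assert (g0 : g 0 = 0) by (unfold g; rewrite c0, Rmult_0_r, exp_0; ring).
      rewrite g0.
      assert (Mt : Cmod (z0 * Cexp (RtoC t)) <= Cmod z0).
      { rewrite Cmod_mult, Cmod_Cexp. change (Re (RtoC t)) with t.
        assert (exp t <= 1).
        { rewrite <- exp_0. destruct (proj2 Ht) as [Hx| ->]; [apply Rlt_le, exp_increasing, Hx | lra]. }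
        nra. }
      assert (Et : theta t = Im (RtoC (/ alpha) * slit_log (p (z0 * Cexp (RtoC t))))%C).
      { unfold theta. rewrite Im_RtoC_mult, Cmult_1_r. reflexivity. }
      assert (T := cayley_Cexp_cos_bound (RtoC (/ alpha) * slit_log (p (z0 * Cexp (RtoC t))))%C
        (exp (INR n * t))).
      rewrite <- Et in T.
      assert (Ee : exp (INR n * t) <= 1).
      { rewrite <- exp_0. assert (Hnt : INR n * t <= 0) by (assert (T1 := pos_INR n); nra).
        destruct Hnt as [Hx| ->]; [apply Rlt_le, exp_increasing, Hx | lra]. }
      unfold g. cut (1 - exp (INR n * t) ^ 2 <= cos (theta t) * (1 + exp (INR n * t) ^ 2)); [lra|].
      apply T.
      + split; [apply Rlt_le, exp_pos | exact Ee].
      + rewrite Et, Im_RtoC_mult. destruct (Hcl _ Mt) as [_ B]. apply Rabs_le_between in B.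
        assert (Ea : / alpha * (alpha * PI / 2) = PI / 2) by (field; lra).
        apply cos_ge_0; nra.
      + rewrite exp_INR_mult. apply Sch'. lra. }
  assert (E : alpha * (/ alpha * Im (z0 * p1 z0 / p z0)%C) = Im (z0 * p1 z0 / p z0)%C)
    by (field; lra).
  assert (G2 : 0 <= alpha * (- (2 * INR n) + 2 * s * (/ alpha * Im (z0 * p1 z0 / p z0)%C)))
    by (apply Rmult_le_pos; lra).
  nra.
Qed.

(** Along z0 exp(i t) the logarithm of p has derivative i P, so arg p has first derivative Re P and
    second derivative - Im (z P'). The long expression in the conclusion is z P' written out. *)
Lemma angular_derivatives (p p1 p2 : C -> C) (a s : R) (z0 : C) :
  in_disc z0 ->
  (forall z, in_disc z -> Cder p z (p1 z)) ->
  (forall z, in_disc z -> Cder p1 z (p2 z)) ->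
  (forall z, Cmod z <= Cmod z0 ->
    0 < Cmod (p z) + Re (p z) /\ Rabs (Im (slit_log (p z))) <= a) ->
  s * s = 1 -> Im (slit_log (p z0)) = s * a ->
  let P := (z0 * p1 z0 / p z0)%C in
  Re P = 0 /\ 0 <= s * Im (P + z0 ^ 2 * p2 z0 / p z0 - P * P)%C.
Proof.
  intros Hz0 D1 D2 Hcl Hs Him P. unfold in_disc in Hz0.
  pose (v := fun x => (z0 * Cexp x)%C).
  pose (F := fun z => (z * p1 z / p z)%C).
  assert (E0 : v (RtoC 0 * Ci)%C = z0) by (unfold v; rewrite Cmult_0_l, Cexp_0; ring).
  assert (Mv : forall t : R, Cmod (v (RtoC t * Ci)%C) = Cmod z0).
  { intros t. unfold v. rewrite Cmod_mult, Cmod_Cexp.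
    replace (Re (RtoC t * Ci)%C) with 0 by (unfold Re, RtoC, Ci, Cmult; simpl; ring).
    rewrite exp_0. ring. }
  assert (Iv : forall t : R, in_disc (v (RtoC t * Ci)%C)) by (intros; unfold in_disc; rewrite Mv; lra).
  assert (Dl : forall t : R, Cder (fun x => slit_log (p (v x))) (RtoC t * Ci)%C (F (v (RtoC t * Ci)%C))).
  { intros t.
    assert (H0 := proj1 (Hcl (v (RtoC t * Ci)%C) (Req_le _ _ (Mv t)))).
    assert (D : Cder (fun x => slit_log (p x)) (v (RtoC t * Ci)%C)
      (p1 (v (RtoC t * Ci)) * / p (v (RtoC t * Ci)))%C).
    { apply (Cder_comp slit_log p); [apply Cder_slit_log, H0 | apply D1; auto]. }
    apply Cder_polar in D. refine (Cder_eq _ _ _ _ D _).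
    unfold F. fold (v (RtoC t * Ci)%C). unfold Cdiv. ring. }
  assert (H0 := slit_neq_0 _ (proj1 (Hcl z0 (Rle_refl _)))).
  assert (DF : Cder (fun x => F (v x)) (RtoC 0 * Ci)%C (P + z0 ^ 2 * p2 z0 / p z0 - P * P)%C).
  { assert (D : Cder F (v (RtoC 0 * Ci)%C)
      (((1 * p1 z0 + z0 * p2 z0) * p z0 - z0 * p1 z0 * p1 z0) / (p z0 * p z0))%C).
    { rewrite E0. apply (Cder_div (fun z => z * p1 z)%C p); [exact H0 | | apply D1, Hz0].
      apply (Cder_mult (fun z => z) p1); [apply Cder_id | apply D2, Hz0]. }
    apply Cder_polar in D. refine (Cder_eq _ _ _ _ D _).
    fold (v (RtoC 0 * Ci)%C). rewrite E0. unfold P. simpl. field. exact H0. }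
  set (P' := (P + z0 ^ 2 * p2 z0 / p z0 - P * P)%C) in *.
  assert (ReCi : forall z, Re (z * Ci)%C = - Im z)
    by (intros; unfold Re, Im, Ci, Cmult; simpl; ring).
  assert (ImCi : forall z, Im (z * Ci)%C = Re z)
    by (intros; unfold Re, Im, Ci, Cmult; simpl; ring).
  destruct (second_derivative_at_max
    (fun t => s * Im (slit_log (p (v (RtoC t * Ci)%C))))
    (fun t => s * Re (F (v (RtoC t * Ci)%C))) (s * Re (P' * Ci)%C) 1) as [Q1 Q2].
  - lra.
  - intros t _. assert (T := proj2 (is_derive_line_0 _ _ _ _ (Dl t))).
    rewrite ImCi in T. apply (is_derive_scal _ _ s _ T).
  - assert (T := proj1 (is_derive_line_0 _ _ _ _ DF)). apply (is_derive_scal _ _ s _ T).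
  - intros t _. rewrite E0, Him.
    destruct (Hcl (v (RtoC t * Ci)%C) (Req_le _ _ (Mv t))) as [_ B]. apply Rabs_le_between in B.
    replace (s * (s * a)) with a by (rewrite <- Rmult_assoc, Hs; ring).
    assert (Hs' : s = 1 \/ s = -1) by (destruct (Rle_lt_dec 0 s); [left | right]; nra).
    destruct Hs' as [-> | ->]; lra.
  - cbv beta in Q1. rewrite E0 in Q1. rewrite ReCi in Q2.
    change (F z0) with P in Q1. split; nra.
Qed.

(** The power series is differentiated termwise twice; its vanishing coefficients give the order of
    p - 1 at 0. *)
Lemma H_class_derivatives (p : C -> C) (n : nat) : H_class (RtoC 1) n p ->
  exists p1 p2 : C -> C,
    (forall z, in_disc z -> Cder p z (p1 z)) /\
    (forall z, in_disc z -> Cder p1 z (p2 z)) /\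
    p (RtoC 0) = RtoC 1 /\
    exists M, forall z, Cmod z <= 1 / 2 -> Cmod (p z - 1)%C <= M * Cmod z ^ n.
Proof.
  intros [_ [c [c0 [cn Hc]]]].
  assert (H : forall z, in_disc z -> Cseries (fun k => c k * z ^ k)%C (p z))
    by (intros z Hz; apply is_pseries_Cseries, Hc, Hz).
  assert (A1 := Cpseries_derive c p H). cbv zeta in A1.
  set (p1 := fun z => CSeries (fun k => CPS_derive c k * z ^ k)%C).
  assert (A2 := Cpseries_derive (CPS_derive c) p1 (fun z Hz => proj1 (A1 z Hz))). cbv zeta in A2.
  exists p1. eexists. split; [|split; [|split]].
  - intros z Hz. apply A1, Hz.
  - intros z Hz. apply A2, Hz.
  - assert (Z : in_disc (RtoC 0)) by (unfold in_disc; rewrite Cmod_0; lra).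
    rewrite <- (Cseries_unique _ _ (H _ Z)). rewrite <- c0.
    apply Cseries_unique, is_pseries_Cseries.
    exact (is_pseries_0 (K := C_AbsRing) (V := C_NormedModule) c).
  - destruct (Cpseries_order_bound c p n H cn) as [M [_ HM]].
    exists M. intros z Hz. rewrite <- c0. apply HM, Hz.
Qed.

Theorem theorem2p1 :
  forall (n : nat) (alpha c : R) (D E p : C -> C),
    (0 < n)%nat ->
    0 < alpha <= 1 ->
    0 <= c ->
    (forall z : C, in_disc z ->
       Rabs (Im (E z)) < INR n * alpha * (Re (D z) - c)) ->
    H_class (RtoC 1) n p ->
    (forall z : C, in_disc z ->
       (RtoC c * z ^ 2 * C_derive (C_derive p) z
        + D z * (z * C_derive p z) + E z * p z = RtoC 0)%C) ->
    (forall z : C, in_disc z -> p z <> RtoC 0) ->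
    subordinate p (fun z : C => Cpow_real ((1 + z) / (1 - z))%C alpha).
Proof.
  intros n alpha c D E p Hn Ha Hc HE HH Hode Hnz.
  destruct (H_class_derivatives p n HH) as [p1 [p2 [D1 [D2 [P0 [M HM]]]]]].
  assert (Pi := PI_RGT_0).
  assert (Ha2 : alpha * PI / 2 <= PI / 2) by nra.
  assert (Ha0 : 0 < alpha * PI / 2) by nra.
  assert (Sector : forall z, in_disc z -> in_sector (alpha * PI / 2) (p z)).
  { apply NNPP. intros Hex.
    destruct (first_exit p p1 (alpha * PI / 2) D1) as [z0 [Hz0 [Nz0 Hlt]]].
    { apply not_all_ex_not in Hex. destruct Hex as [z Hz]. exists z.
      apply imply_to_and in Hz. exact Hz. }
    assert (Hz00 : z0 <> RtoC 0).
    { intros ->. apply Nz0. rewrite P0. split; [rewrite Cmod_1; simpl; lra|].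
      rewrite slit_log_1. simpl. rewrite Rabs_R0. exact Ha0. }
    assert (Hcl : forall z, Cmod z <= Cmod z0 ->
      0 < Cmod (p z) + Re (p z) /\ Rabs (Im (slit_log (p z))) <= alpha * PI / 2).
    { intros z Hz. apply (closure_of_sector p p1 (alpha * PI / 2) z0 z); auto.
      apply Hnz. unfold in_disc in *. lra. }
    destruct (Hcl z0 (Rle_refl _)) as [S0 B0].
    (* The value p(z0) lies in the closed sector but not in the open one, hence on one of the two
       bounding rays; s tells which. *)
    assert (Eq : Rabs (Im (slit_log (p z0))) = alpha * PI / 2).
    { apply Rle_antisym; auto. apply Rnot_lt_le. intros T. apply Nz0. split; auto. }
    assert (Hs : exists s, s * s = 1 /\ Im (slit_log (p z0)) = s * (alpha * PI / 2)).
    { destruct (Rle_lt_dec 0 (Im (slit_log (p z0)))).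
      - exists 1. rewrite Rabs_right in Eq; lra.
      - exists (-1). rewrite Rabs_left in Eq; lra. }
    destruct Hs as [s [Hs Him]].
    assert (K1 := radial_derivative_bound p p1 p2 alpha M s n z0 Hn (proj1 Ha) Hz0 Hz00
      D1 D2 P0 HM Hcl Hs Him).
    destruct (angular_derivatives p p1 p2 (alpha * PI / 2) s z0 Hz0 D1 D2 Hcl Hs Him) as [K2 K3].
    assert (C1 : forall z, in_disc z -> C_derive p z = p1 z)
      by (intros z Hz; apply is_C_derive_unique, D1, Hz).
    assert (C2 : C_derive (C_derive p) z0 = p2 z0).
    { apply is_C_derive_unique.
      (* [C_derive p] is known to equal [p1] only inside the disc, so the second derivative is
         compared on the ball of radius 1 - |z0| about z0. *)
      apply (Cder_ext_loc p1 (C_derive p) z0 (p2 z0) (1 - Cmod z0)); [unfold in_disc in Hz0; lra | |apply D2, Hz0].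
      intros x Hx. symmetry. apply C1.
      assert (T := Cmod_triangle (x - z0) z0). replace (x - z0 + z0)%C with x in T by ring.
      unfold in_disc. lra. }
    specialize (Hode z0 Hz0). rewrite C1, C2 in Hode by auto.
    specialize (Hnz z0 Hz0). specialize (HE z0 Hz0).
    set (P := (z0 * p1 z0 / p z0)%C) in *.
    set (W := (P + z0 ^ 2 * p2 z0 / p z0 - P * P)%C) in *.
    (* W is z P' at z0, so that W - P + P^2 = z0^2 p'' / p. *)
    assert (Ode : (RtoC c * (W - P + P * P) + D z0 * P + E z0 = RtoC 0)%C).
    { transitivity ((RtoC c * z0 ^ 2 * p2 z0 + D z0 * (z0 * p1 z0) + E z0 * p z0) / p z0)%C.
      - unfold W, P. simpl. field. auto.
      - rewrite Hode. field. auto. }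
    apply (f_equal Im) in Ode.
    (* Since Re P = 0, the square P^2 is real and Im (D P) = Re D * Im P. *)
    assert (Ode' : c * (Im W - Im P) + Re (D z0) * Im P + Im (E z0) = 0).
    { rewrite <- (Rplus_0_r 0) at 1. change (Im (RtoC 0)) with 0 in Ode.
      rewrite Rplus_0_r. rewrite <- Ode. clearbody P W.
      revert K2. unfold Re, Im, Cminus, Cplus, Copp, Cmult, RtoC; simpl. intros ->. ring. }
    assert (Dc : 0 < Re (D z0) - c).
    { assert (T := Rabs_pos (Im (E z0))). assert (0 < INR n) by (apply lt_0_INR; auto).
      assert (0 < INR n * alpha) by (apply Rmult_lt_0_compat; lra). nra. }
    assert (Se : - (INR n * alpha * (Re (D z0) - c)) < s * Im (E z0)).
    { apply Rabs_def2 in HE. destruct (Rle_lt_dec 0 s) as [Hs0|Hs0].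
      - replace s with 1 by nra. lra.
      - replace s with (-1) by nra. lra. }
    assert (K4 : INR n * alpha * (Re (D z0) - c) <= s * Im P * (Re (D z0) - c))
      by (apply Rmult_le_compat_r; lra).
    assert (K5 : 0 <= c * (s * Im W)) by (apply Rmult_le_pos; auto).
    (* Grouped as c s Im W + (Re D - c) s Im P + s Im E: the first term is nonnegative, and the
       second strictly outweighs the third. *)
    assert (Z : s * (c * (Im W - Im P) + Re (D z0) * Im P + Im (E z0)) = 0)
      by (rewrite Ode'; ring).
    lra. }
  (* Solving ((1 + w) / (1 - w))^alpha = p for w. *)
  exists (fun z => cayley (slit_root alpha (p z))).
  assert (Pos : forall z, in_disc z -> 0 < Re (slit_root alpha (p z))).
  { intros z Hz. apply Re_slit_root; [apply Ha | apply Sector, Hz]. }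
  split; [|split; [|split]].
  - intros z Hz. eexists. apply (Cder_comp (fun x => cayley (slit_root alpha x)) p).
    + apply Cder_cayley_root; [apply Sector, Hz | apply Re_ge0_plus_1_neq_0, Rlt_le, Pos, Hz].
    + apply D1, Hz.
  - intros z Hz. apply Cmod_cayley_lt_1, Pos, Hz.
  - rewrite P0, slit_root_1. apply cayley_1.
  - intros z Hz. rewrite cayley_inv by (apply Rlt_le, Pos, Hz).
    destruct (Sector z Hz) as [S1 S2].
    (* The root has argument of modulus at most PI / 2 < PI, so its principal logarithm is the
       exponent it was built from, and the factors alpha and 1 / alpha cancel. *)
    unfold Cpow_real, slit_root. rewrite Clog_Cexp.
    + replace (RtoC alpha * (RtoC (/ alpha) * slit_log (p z)))%C with (slit_log (p z)).
      * symmetry. apply Cexp_slit_log, S1.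
      * rewrite Cmult_assoc, <- RtoC_mult, Rinv_r by lra. ring.
    + rewrite Im_RtoC_mult, Rabs_mult, Rabs_right by (apply Rle_ge, Rlt_le, Rinv_0_lt_compat, Ha).
      apply Rle_lt_trans with (/ alpha * (alpha * PI / 2)).
      * apply Rmult_le_compat_l; [apply Rlt_le, Rinv_0_lt_compat, Ha | lra].
      * replace (/ alpha * (alpha * PI / 2)) with (PI / 2) by (field; lra). lra.
Qed.
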